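(* Let $M$ be a positive integer. Suppose that there exists an infinite non-torsion topological Abelian group $H$ without non-trivial convergent sequences such that $H^M$ is countably compact. Then there exists a topological free Abelian group $G$ such that $G^M$ is countably compact and $G^{M+1}$ is not countably compact.
   Context: All topological groups are Hausdorff, and powers carry the product topology. A group is non-torsion if it has an element of infinite order. A topological free Abelian group is a free Abelian group (as an abstract group) endowed with a group topology. A space is countably compact if every sequence in it has an accumulation point, where $x$ is an accumulation point of $(x_n)_{n\in\omega}$ if every neighbourhood of $x$ contains $x_n$ for infinitely many $n$. A non-trivial convergent sequence is a convergent sequence that is not eventually constant. *)

(* Defs.v *)
From HB Require Import structures.
From mathcomp Require Import all_boot all_algebra.
From mathcomp Require Import boolp classical_sets cardinality.
From mathcomp Require Import topology tvs.
From mathcomp Require Import freeg.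

Set Implicit Arguments.
Unset Strict Implicit.
Unset Printing Implicit Defensive.

Import GRing.Theory.
Local Open Scope classical_set_scope.
Local Open Scope ring_scope.

Definition accumulation_point (T : topologicalType) (u : nat -> T) (x : T) :=
  forall U : set T, nbhs x U -> infinite_set (u @^-1` U).

Definition countably_compact (T : topologicalType) :=
  forall u : nat -> T, exists x : T, accumulation_point u x.

Definition convergent_sequence (T : topologicalType) (u : nat -> T) :=
  exists x : T, u n @[n --> \oo] --> x.

Definition eventually_constant (T : Type) (u : nat -> T) :=
  exists x : T, \forall n \near \oo, u n = x.

Definition nontrivial_convergent_sequence (T : topologicalType)
    (u : nat -> T) :=
  convergent_sequence u /\ ~ eventually_constant u.

Definition non_torsion (A : zmodType) :=
  exists x : A, forall n : nat, (0 < n)%N -> x *+ n <> 0.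

(* [{freeg I}] consists of the formal sums over [I] with coefficients in [int]
   and finite support; [f] is an isomorphism of abstract groups. *)
Definition free_abelian (A : zmodType) :=
  exists (I : choiceType) (f : {additive {freeg I} -> A}), bijective f.

(* Main.v *)
(* Let H be as in the hypothesis, C = 2^nat, K a power of Z/2 and E = H x K, so
   that E^M is still countably compact.  A homomorphism from a free abelian
   group F to E, injective in the first coordinate, is built by recursion of
   length the continuum, and G is F with the topology induced from E.  At each
   step a sequence in F^M is given, all of whose nontrivial integer combinations
   are finite-to-one, and M new generators are sent to one of its accumulation
   points.  Up to constants and integer combinations, every sequence in F^M has a
   subsequence of this kind, so G^M is countably compact.

   Since H has no nontrivial convergent sequence, a binary tree of infinite sets
   of indices gives accumulation points a_b, b in C, such that k.a_b <> k.a_c for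
   every nonzero integer vector k and all b <> c.  An equation k.a = const thus
   excludes at most one b, and fewer than continuum many equations can be avoided.
   This keeps the images of the generators independent.  It also keeps G^(M+1)
   from being countably compact: F contains a sequence w of (M+1)-tuples of basis
   elements whose image in K^(M+1) takes every 0-1 pattern in every coordinate
   direction.  If h + T a and h + T a' were distinct accumulation points of w, they
   would be separated by some set A of indices, and the coordinates attached to A
   would factor the identity matrix of size M+1 over Z/2 through a space of
   dimension M.  So h + T a avoids the accumulation points of w as soon as a
   avoids one equation for each of the fewer than continuum many pairs (h, T). *)

Require Import Defs.
From HB Require Import structures.
From mathcomp Require Import all_boot all_algebra.
From mathcomp Require Import boolp classical_sets functions cardinality wochoice.
From mathcomp Require Import topology tvs.
From mathcomp Require Import freeg.

Set Implicit Arguments.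
Unset Strict Implicit.
Unset Printing Implicit Defensive.

Import GRing.Theory.
Local Open Scope classical_set_scope.
Local Open Scope ring_scope.

(** * Embeddings into the continuum *)

Definition embeds (S T : Type) := exists f : S -> T, injective f.

Lemma embeds_trans (S T U : Type) : embeds S T -> embeds T U -> embeds S U.
Proof. by move=> [f fI] [g gI]; exists (g \o f); apply: inj_comp. Qed.

Lemma embeds_fun (I S T : Type) : embeds S T -> embeds (I -> S) (I -> T).
Proof.
move=> [f fI]; exists (fun u => f \o u) => u v uv.
by apply/funext => i; apply: fI; exact: (congr1 (fun w => w i) uv).
Qed.

Lemma embeds_cover (A P T : Type) (g : A -> T) (f : P -> T) :
  injective g -> (forall a, exists p, f p = g a) -> embeds A P.
Proof.
move=> gI /choice[h hP]; exists h => a b hab.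
by apply: gI; rewrite -!hP hab.
Qed.

Notation cantor := (nat -> bool).

Lemma embeds_fun_cantor : embeds (nat -> cantor) cantor.
Proof.
exists (fun u n => if @unpickle (nat * nat)%type n is Some (i, j) then u i j else false).
move=> u v uv; apply/funext => i; apply/funext => j.
by have := congr1 (fun w => w (pickle (i, j))) uv; rewrite /= pickleK.
Qed.

Lemma embeds_countable_cantor (T : countType) : embeds T cantor.
Proof.
exists (fun x n => pickle x == n) => x y xy.
have := congr1 (fun w => w (pickle y)) xy; rewrite /= eqxx => /eqP.
exact: (pcan_inj pickleK).
Qed.

Lemma embeds_prod_cantor (S T : Type) :
  embeds S cantor -> embeds T cantor -> embeds (S * T) cantor.
Proof.
move=> [f fI] [g gI]; apply: embeds_trans embeds_fun_cantor.
exists (fun p n => if n is 0%N then f p.1 else g p.2) => -[a b] [c d] /= ab.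
have /fI -> := congr1 (fun w => w 0%N) ab.
by have /gI -> := congr1 (fun w => w 1%N) ab.
Qed.

Lemma embeds_sum_cantor (S T : Type) :
  embeds S cantor -> embeds T cantor -> embeds (S + T) cantor.
Proof.
move=> [f fI] [g gI]; apply: embeds_trans embeds_fun_cantor.
(* Row [0] is a tag that tells the two summands apart; the later rows carry the value. *)
exists (fun p n => match p with
  | inl x => if n is 0%N then xpredT else f x
  | inr y => if n is 0%N then xpred0 else g y end).
move=> [a|a] [b|b] ab; do ?by have := congr1 (fun w => w 0%N 0%N) ab.
  by have /fI -> := congr1 (fun w => w 1%N) ab.
by have /gI -> := congr1 (fun w => w 1%N) ab.
Qed.

Lemma embeds_seq_cantor (S : Type) : embeds S cantor -> embeds (seq S) cantor.
Proof.
move=> SC.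
have SO : embeds (unit + S) cantor.
  by apply: embeds_sum_cantor => //; exact: embeds_countable_cantor.
apply: embeds_trans embeds_fun_cantor.
apply: embeds_trans (embeds_fun nat SO).
exists (fun s n => if onth s n is Some x then inr x else inl tt).
elim=> [|x s IHs] [|y t] //= st.
- by have := congr1 (fun w => w 0%N) st.
- by have := congr1 (fun w => w 0%N) st.
have [->] := congr1 (fun w => w 0%N) st.
congr (_ :: _); apply: IHs; apply/funext => n.
exact: (congr1 (fun w => w n.+1) st).
Qed.

(** [tree S] bounds the size of everything finitely generated from [S]: countable data, pairs, sums
    and finite sequences all embed in it. Such embeddings take the place of cardinal arithmetic. *)
Notation tree := GenTree.tree.

Lemma embeds_leaf (S : Type) : embeds S (tree S).
Proof. by exists (@GenTree.Leaf S) => x y []. Qed.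

Lemma embeds_countable_tree (T : countType) (S : Type) : embeds T (tree S).
Proof.
exists (fun x => GenTree.Node (pickle x) [::]) => x y [].
exact: (pcan_inj pickleK).
Qed.

Lemma embeds_seq_tree (S T : Type) : embeds T (tree S) -> embeds (seq T) (tree S).
Proof.
move=> [f fI]; exists (fun s => GenTree.Node 0 (map f s)) => s t [].
exact: inj_map.
Qed.

Lemma embeds_prod_tree (S T U : Type) :
  embeds T (tree S) -> embeds U (tree S) -> embeds (T * U) (tree S).
Proof.
move=> [f fI] [g gI]; exists (fun p => GenTree.Node 0 [:: f p.1; g p.2]).
by move=> [a b] [c d] [/fI-> /gI->].
Qed.

Lemma embeds_sum_tree (S T U : Type) :
  embeds T (tree S) -> embeds U (tree S) -> embeds (T + U) (tree S).
Proof.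
move=> [f fI] [g gI].
exists (fun p => match p with
  inl x => GenTree.Node 0 [:: f x] | inr y => GenTree.Node 1 [:: g y] end).
by move=> [a|a] [b|b] // [] => [/fI|/gI] ->.
Qed.

Lemma embeds_tree_seq (S : Type) : embeds (tree S) (seq (nat + S)).
Proof. exists (@GenTree.encode S); exact: (pcan_inj (@GenTree.codeK S)). Qed.

(** Trees are coded by words, so a tree whose leaves are themselves trees flattens to a single tree:
    the bound is idempotent. *)
Lemma embeds_tree (S T : Type) : embeds S (tree T) -> embeds (tree S) (tree T).
Proof.
move=> ST; apply: embeds_trans (embeds_tree_seq S) _.
apply: embeds_seq_tree; apply: embeds_sum_tree => //.
exact: embeds_countable_tree.
Qed.

(** Cantor's diagonal argument: [b] is built to disagree with every [c] at the code of [f c]. *)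
Lemma not_embeds_cantor_countable (T : countType) : ~ embeds cantor T.
Proof.
move=> [f fI].
pose b n := ~~ `[< exists2 c : cantor, pickle (f c) = n & c n >].
have [bn|bn] := boolP (b (pickle (f b))).
  by move: (bn) => /asboolPn; apply; exists b.
move: (bn); rewrite negbK => /asboolP[c /(pcan_inj pickleK)/fI ->].
by rewrite (negbTE bn).
Qed.

Lemma embeds_freeg (K : choiceType) (P : Type) :
  embeds (seq (int * K)) P -> embeds {freeg K} P.
Proof.
apply: embeds_trans; exists (fun D => [seq (coeff x D, x) | x <- dom D]).
by move=> D E DE; rewrite -(Freeg_dom D) DE Freeg_dom.
Qed.

Lemma embeds_ffun (I : finType) (S P : Type) :
  embeds (seq S) P -> embeds {ffun I -> S} P.
Proof.
apply: embeds_trans; exists (fun f => tval (fgraph f)) => f g /val_inj.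
exact: (can_inj fgraphK).
Qed.

(** * Well-orders *)

(** Irreflexivity and transitivity follow from these two clauses, see [swo_irr] and [swo_trans]. *)
Definition strict_well_order (T : Type) (lt : T -> T -> Prop) :=
  well_founded lt /\ forall x y, x <> y -> lt x y \/ lt y x.

Section StrictWellOrder.
Variables (T : Type) (lt : T -> T -> Prop).
Hypothesis lt_swo : strict_well_order lt.

Lemma swo_min (P : T -> Prop) :
  (exists x, P x) -> exists x, P x /\ forall y, lt y x -> ~ P y.
Proof.
move=> [x]; elim/(well_founded_ind lt_swo.1): x => x IHx Px.
have [[y ltyx Py]|noy] := pselect (exists2 y, lt y x & P y); first exact: IHx Py.
by exists x; split=> // y ltyx Py; apply: noy; exists y.
Qed.

Lemma swo_irr x : ~ lt x x.
Proof.
have [y [-> miny]] := @swo_min (eq x) (ex_intro _ x erefl).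
by move=> ltyy; apply: miny ltyy _.
Qed.

Lemma swo_asym x y : lt x y -> ~ lt y x.
Proof.
move=> xy yx.
have [z [[->|->] minz]] := @swo_min (fun z => z = x \/ z = y) (ex_intro _ x (or_introl erefl)).
  by apply: minz yx _; right.
by apply: minz xy _; left.
Qed.

(** A cycle through [x], [y] and [z] would leave these three points without a minimal one. *)
Lemma swo_trans x y z : lt x y -> lt y z -> lt x z.
Proof.
move=> xy yz.
have [xz|/lt_swo.2[//|zx]] := pselect (x = z).
  by move: yz; rewrite -xz => /(swo_asym xy).
exfalso; have [w [[->|->|->] minw]] :=
  @swo_min (fun w => [\/ w = x, w = y | w = z]) (ex_intro _ x (Or31 _ _ erefl)).
- by apply: minw zx _; constructor 3.
- by apply: minw xy _; constructor 1.
- by apply: minw yz _; constructor 2.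
Qed.

(** Since the order is total, [~ lt z y] plays the role of y <= z, here and below. *)
Lemma swo_lt_nlt_trans x y z : lt x y -> ~ lt z y -> lt x z.
Proof.
move=> xy zy; have [<-//|/lt_swo.2[yz|/zy//]] := pselect (y = z).
exact: swo_trans xy yz.
Qed.

Lemma swo_nlt_nlt_trans x y z : ~ lt y x -> ~ lt z y -> ~ lt z x.
Proof. by move=> yx zy zx; apply: zy; apply: swo_lt_nlt_trans zx _. Qed.

Lemma swo_seq_max (A : eqType) (rk : A -> T) (s : seq A) :
  s <> [::] -> exists2 x, x \in s & forall y, y \in s -> ~ lt (rk x) (rk y).
Proof.
elim: s => // x [_ _|z s IHs _].
  exists x; rewrite ?mem_head// => y; rewrite inE => /eqP ->.
  exact: swo_irr.
have [//|y ys maxy] := IHs.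
have [xy|xy] := pselect (lt (rk x) (rk y)).
  exists y; first by rewrite inE ys orbT.
  by move=> t; rewrite inE => /predU1P[->|/maxy//]; apply: swo_asym.
exists x; first exact: mem_head.
move=> t; rewrite inE => /predU1P[->|/maxy yt]; first exact: swo_irr.
exact: swo_nlt_nlt_trans yt xy.
Qed.

End StrictWellOrder.

Lemma strict_well_order_exists (T : Type) :
  exists lt : T -> T -> Prop, strict_well_order lt.
Proof.
have [R Rwo] := well_ordering_principle {classic T}.
have Rwo' : wo_chain R predT by apply: withinW.
exists (fun x y => R x y /\ x <> y); split; last first.
  move=> x y xy; have /orP[] : R x y || R y x by exact: (wo_chainW Rwo').
    by left.
  by right; split=> // /esym.
move=> x; apply: contrapT => nx.
have [|z [[/asboolP nz minz] _]] := Rwo [pred y | `[< ~ Acc (fun x y => R x y /\ x <> y) y >]].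
  by exists x; apply/asboolP.
apply: nz; split=> y [Ryz yz]; apply: contrapT => ny.
apply: yz; apply: (wo_chain_antisymmetric Rwo') => //.
by rewrite Ryz/=; apply: minz; apply/asboolP.
Qed.

Lemma strict_well_order_lex (T U : Type) (rk : U -> T) lt (lt' : U -> U -> Prop) :
  strict_well_order lt -> strict_well_order lt' ->
  strict_well_order (fun u v => lt (rk u) (rk v) \/ rk u = rk v /\ lt' u v).
Proof.
move=> lt_swo lt'_swo; split; last first.
  move=> u v /lt'_swo.2 uv; have [ruv|/lt_swo.2[]] := pselect (rk u = rk v).
  - by case: uv; [left|right]; right.
  - by left; left.
  - by right; left.
move=> u; move er : (rk u) => r.
elim/(well_founded_ind lt_swo.1): r u er => r IHr u.
elim/(well_founded_ind lt'_swo.1): u => u IHu er.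
split=> v [lvu|[rvu lvu]]; first by apply: IHr (erefl (rk v)); rewrite -er.
by apply: IHu => //; rewrite rvu.
Qed.

(** * Initial segments of the continuum *)

Section MinimalSegment.
Variables (C : Type) (ltC : C -> C -> Prop).
Hypothesis ltC_swo : strict_well_order ltC.

(** [D] is the segment below the least point over whose predecessors the finite trees already reach
    the size of the continuum, or everything if there is no such point. *)
Lemma minimal_segment : exists D : C -> Prop, embeds C (tree {x | D x}) /\
  forall x, D x -> ~ embeds C (tree {y | D y /\ ltC y x}).
Proof.
have [[x xP]|noP] := pselect (exists x, embeds C (tree {y | ltC y x})).
  have [z [zP zmin]] := swo_min ltC_swo (ex_intro (fun x => embeds C (tree {y | ltC y x})) x xP).
  exists (fun y => ltC y z); split=> // y yz Cy; apply: (zmin y yz).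
  apply: embeds_trans Cy _; apply: embeds_tree.
  apply: embeds_trans (embeds_leaf _).
  exists (fun w => exist _ (sval w) (proj2 (svalP w))) => -[a ?] [b ?] [] ab.
  exact: eq_exist.
exists (fun=> True); split.
  apply: embeds_trans (embeds_leaf _); exists (fun x => exist _ x I).
  by move=> x y [].
move=> x _ Cx; apply: noP; exists x.
apply: embeds_trans Cx _; apply: embeds_tree.
apply: embeds_trans (embeds_leaf _).
exists (fun w => exist _ (sval w) (proj2 (svalP w))) => -[a ?] [b ?] [] ab.
exact: eq_exist.
Qed.

End MinimalSegment.

Lemma strict_well_order_sub (T U : Type) (f : U -> T) (lt : T -> T -> Prop) :
  injective f -> strict_well_order lt -> strict_well_order (fun u v => lt (f u) (f v)).
Proof.
move=> fI lt_swo; split; last first.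
  by move=> u v uv; apply: lt_swo.2 => /fI.
move=> u; move eu : (f u) => x; elim/(well_founded_ind lt_swo.1): x u eu => x IHx u eu.
by split=> v; rewrite eu => /IHx; apply.
Qed.

Section SeqRank.
Variables (I : Type) (lt : I -> I -> Prop).
Hypothesis lt_swo : strict_well_order lt.

(** The maximum of all elements of [I] occurring in [w]; the component [w.1] makes it defined when
    the word is empty. *)
Definition seq_rank (w : I * seq (nat + I)) : I :=
  foldr (fun e m => if e is inr y then (if `[< lt y m >] then m else y) else m)
    w.1 w.2.

(** Bounds the number of words of rank at most [z] by the number of words over the segment up to
    [z]. *)
Lemma seq_rank_cover z w : ~ lt z (seq_rank w) ->
  exists p : {y | ~ lt z y} * seq (nat + {y | ~ lt z y}),
    (sval p.1,
     map (fun e => match e with inl n => inl n | inr y => inr (sval y) end) p.2) = w.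
Proof.
case: w => x; elim=> [|[n|y] s IHs] /=.
- by move=> zx; exists (exist _ x zx, [::]).
- move=> /IHs[[x' s'] /= [<- <-]]; by exists (x', inl n :: s').
rewrite /seq_rank/=; case: asboolP => ym zm; last first.
  have [|[x' s'] /= [<- <-]] := IHs; last by exists (x', inr (exist _ y zm) :: s').
  exact: (swo_nlt_nlt_trans lt_swo ym).
have [//|[x' s'] /= [<- <-]] := IHs.
have zy : ~ lt z y by move=> zy; apply: zm; apply: (swo_trans lt_swo) zy ym.
by exists (x', inr (exist _ y zy) :: s').
Qed.

End SeqRank.

(* Finite trees over a minimal segment of the continuum that is large enough,
   ordered first by their largest leaf: this avoids the theorem that the square
   of an infinite cardinal is equipotent to it. *)
Lemma continuum_order :
  exists (W : choiceType) (lt : W -> W -> Prop),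
    [/\ strict_well_order lt, embeds cantor W, embeds W cantor &
        forall x, ~ embeds cantor (tree {y | ~ lt x y})].
Proof.
have [ltC ltC_swo] := strict_well_order_exists cantor.
have [D [CD Dmin]] := minimal_segment ltC_swo.
pose I := {x | D x}; pose ltI (x y : I) := ltC (sval x) (sval y).
have svalI : injective (sval : I -> cantor) by move=> [a ?] [b ?] /= ab; apply: eq_exist.
have ltI_swo : strict_well_order ltI by exact: strict_well_order_sub.
have [lt' lt'_swo] := strict_well_order_exists (I * seq (nat + I)).
pose W := {classic (I * seq (nat + I))}.
pose ltW (u v : W) := ltI (seq_rank ltI u) (seq_rank ltI v) \/
  seq_rank ltI u = seq_rank ltI v /\ lt' u v.
exists W, ltW.
have IC : embeds I cantor by exists sval.
split; first exact: (strict_well_order_lex (seq_rank ltI) ltI_swo lt'_swo).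
- apply: (embeds_trans CD); apply: embeds_trans (embeds_tree_seq _) _.
  (* The first component needs a point of [I]. If [I] were empty, the continuum would embed in the
     countable type [tree void]. *)
  have [[i]|noI] := pselect (inhabited I).
    by exists (fun s => (i, s) : I * seq (nat + I)) => s t [].
  have Iv : embeds I (tree void).
    have noi (i : I) : False by apply: noI; exists.
    by exists (fun i => False_rect _ (noi i)) => i; case: (noi i).
  have := embeds_trans CD (embeds_tree Iv).
  by move=> /not_embeds_cantor_countable.
- apply: embeds_prod_cantor => //; apply: embeds_seq_cantor.
  apply: embeds_sum_cantor => //; exact: embeds_countable_cantor.
(* A point not above [w] has rank at most that of [w], so it is a word over [S]. *)
move=> w Cw; pose S := {y : I | ~ ltI (seq_rank ltI w) y}.
have CS : embeds cantor (tree S).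
  apply: embeds_trans Cw _; apply: embeds_tree.
  apply: (@embeds_trans _ (S * seq (nat + S))).
    apply: (@embeds_cover _ _ (I * seq (nat + I)) sval
      (fun p => (sval p.1, map (fun e => match e with inl n => inl n | inr y => inr (sval y) end) p.2))).
      by move=> [a ?] [b ?] /= ab; apply: eq_exist.
    by move=> [v /= /not_orP[vw _]]; apply: seq_rank_cover ltI_swo _ _ vw.
  apply: embeds_prod_tree; first exact: embeds_leaf.
  apply: embeds_seq_tree; apply: embeds_sum_tree; last exact: embeds_leaf.
  exact: embeds_countable_tree.
move: (seq_rank ltI w) @S CS => [x Dx] S CS.
apply: (Dmin x Dx); apply: embeds_trans CS _; apply: embeds_tree.
(* The segment up to [x] has just one point more than the segment below [x], which is too small by
   the choice of [D]. *)
apply: (@embeds_trans _ (unit + {y | D y /\ ltC y x})); last first.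
  by apply: embeds_sum_tree; [exact: embeds_countable_tree|exact: embeds_leaf].
apply: (@embeds_cover _ _ cantor (fun y : S => sval (sval y))
  (fun p => match p with inl _ => x | inr y => sval y end)).
  by move=> [a ?] [b ?] /= /svalI ab; apply: eq_exist.
move=> [[y Dy] /= yx]; have [->|/ltC_swo.2[yx'|//]] := pselect (y = x).
  by exists (inl tt).
by exists (inr (exist _ y (conj Dy yx'))).
Qed.

(** * Cofinality of the continuum and enumerations with cofinal repetition *)

Section Continuum.
Variables (W : Type) (lt : W -> W -> Prop).
Hypothesis lt_swo : strict_well_order lt.
Hypothesis embeds_cantorW : embeds cantor W.
Hypothesis embeds_Wcantor : embeds W cantor.
Hypothesis small : forall x, ~ embeds cantor (tree {y | ~ lt x y}).

(* Koenig's argument for the uncountable cofinality of the continuum. *)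
Lemma countable_bounded (u : nat -> W) : exists x, forall n, lt (u n) x.
Proof.
apply: contrapT => nox.
have [g gI] := embeds_trans embeds_fun_cantor embeds_cantorW.
(* The points [g z] not above [u n] are too few for their coordinates [z n] to exhaust [cantor];
   [y n] is a value that they miss. *)
have /choice[y yP] n : exists y, forall z, z n = y -> lt (u n) (g z).
  apply: contrapT => noy.
  have /choice[h hP] y : exists z, z n = y /\ ~ lt (u n) (g z).
    apply: contrapT => noz; apply: noy; exists y => z zy.
    by apply: contrapT => nlt; apply: noz; exists z.
  apply: (small (x := u n)); apply: embeds_trans (embeds_leaf _).
  exists (fun y => exist _ (g (h y)) (hP y).2) => a b [] /gI hab.
  by rewrite -(hP a).1 -(hP b).1 hab.
apply: nox; exists (g y) => n; exact: yP.
Qed.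

(** With [g] coding pairs (t, v) by points of [W], the map [f] decodes the first component. Each [t]
    then has continuum many codes, and they cannot all lie at or before [x]. *)
Lemma cofinal_enumeration (T : Type) : inhabited T -> embeds T cantor ->
  exists f : W -> T, forall t x, exists2 y, lt x y & f y = t.
Proof.
move=> [t0] TC.
have [g gI] := embeds_trans (embeds_prod_cantor TC embeds_Wcantor) embeds_cantorW.
have /choice[f fP] : forall y, exists t, forall t' x, g (t', x) = y -> t = t'.
  move=> y; have [[[t x] <-]|noy] := pselect (exists p, g p = y).
    by exists t => t' x' /gI[].
  by exists t0 => t x txy; case: noy; exists (t, x).
exists f => t x; apply: contrapT => noy.
apply: (small (x := x)); apply: embeds_trans embeds_cantorW _.
apply: embeds_trans (embeds_leaf _).
have gP v : ~ lt x (g (t, v)).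
  by move=> xg; apply: noy; exists (g (t, v)) => //; apply: fP erefl.
by exists (fun v => exist _ (g (t, v)) (gP v)) => a b [] /gI[].
Qed.

End Continuum.

(** Recursion with choice along a well-order, for a condition that depends only on the earlier
    values. The earlier values may be assumed to satisfy it when the next one is sought. *)
Lemma wf_choice (W : Type) (lt : W -> W -> Prop) (V : Type)
    (P : W -> (W -> V) -> V -> Prop) (v0 : V) :
  strict_well_order lt ->
  (forall x u u' v, (forall y, lt y x -> u y = u' y) -> P x u v -> P x u' v) ->
  (forall x u, (forall y, lt y x -> P y u (u y)) -> exists v, P x u v) ->
  exists u, forall x, P x u (u x).
Proof.
move=> lt_swo Pext Pex.
(* [v0] is only a filler: by [Pext], values at points not below [x] are irrelevant. *)
pose ext x (u : forall y, lt y x -> V) y :=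
  if pselect (lt y x) is left h then u y h else v0.
have /choice[sel selP] (p : W * (W -> V)) : exists v, (exists v', P p.1 p.2 v') -> P p.1 p.2 v.
  have [[v Pv]|nov] := pselect (exists v, P p.1 p.2 v); first by exists v.
  by exists v0 => /nov.
pose F x (u : forall y, lt y x -> V) := sel (x, ext x u).
pose u := Fix lt_swo.1 (fun=> V) F.
have uE x : u x = sel (x, ext x (fun y _ => u y)).
  rewrite {1}/u Fix_eq// => y f g fg; congr F; apply: functional_extensionality_dep => z.
  by apply: functional_extensionality_dep => h; exact: fg.
have extE x y : lt y x -> ext x (fun y _ => u y) y = u y.
  by rewrite /ext; case: pselect.
exists u; elim/(well_founded_ind lt_swo.1) => x IHx.
apply: (Pext x _ _ _ (extE x)); rewrite uE; apply: (selP (x, _)) => /=.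
have [v Pv] := Pex x u IHx.
by exists v; apply: Pext Pv => y /extE.
Qed.

(** * Accumulation points *)

Definition frequently (A : nat -> Prop) := forall N, exists2 n, (N <= n)%N & A n.

Definition finite_to_one (T : Type) (u : nat -> T) :=
  forall c, exists N, forall n, (N <= n)%N -> u n <> c.

Lemma infinite_frequently (A : set nat) : infinite_set A <-> frequently A.
Proof.
split=> [infA N|freqA].
  apply: contrapT => noA; apply: infA.
  apply: sub_finite_set (finite_II N) => n An /=.
  by rewrite ltnNge; apply/negP => Nn; apply: noA; exists n.
move=> /finite_seqP[X AX].
have [n] := freqA (\max_(x <- X) x).+1; rewrite AX /= => ltn nX.
by move: ltn; rewrite ltnNge (leq_bigmax_seq n).
Qed.

Lemma increasing_choice (A : nat -> nat -> Prop) : (forall n, frequently (A n)) ->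
  exists2 s : nat -> nat, {homo s : m n / (m < n)%N} & forall n, A n (s n).
Proof.
move=> freqA.
have /choice[h hP] (p : nat * nat) : exists m, (p.2 <= m)%N /\ A p.1 m.
  by have [m pm Am] := freqA p.1 p.2; exists m.
pose fix s n := if n is n'.+1 then h (n, (s n').+1) else h (0%N, 0%N).
exists s; last by case=> [|n]; exact: (hP (_, _)).2.
by apply: homo_ltn => [m n p|n]; [exact: ltn_trans|exact: (hP (_, _)).1].
Qed.

Lemma increasing_geid (s : nat -> nat) : {homo s : m n / (m < n)%N} ->
  forall n, (n <= s n)%N.
Proof.
by move=> sI; elim=> // n IHn; apply: leq_ltn_trans IHn _; apply: sI.
Qed.

Lemma accumulationP (T : topologicalType) (u : nat -> T) x :
  accumulation_point u x <->
  forall U, nbhs x U -> frequently (fun n => U (u n)).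
Proof. by split=> ux U /ux; rewrite infinite_frequently. Qed.

Lemma accumulation_subseq (T : topologicalType) (u : nat -> T) s x :
  {homo s : m n / (m < n)%N} -> accumulation_point (u \o s) x ->
  accumulation_point u x.
Proof.
move=> sI /accumulationP usx; apply/accumulationP => U /usx freqU N.
have [n Nn Un] := freqU N; exists (s n) => //.
exact: leq_trans Nn (increasing_geid sI n).
Qed.

Lemma accumulation_comp (T U : topologicalType) (f : T -> U) u x :
  continuous f -> accumulation_point u x -> accumulation_point (f \o u) (f x).
Proof.
move=> fC /accumulationP ux; apply/accumulationP => V fxV.
exact: (ux (f @^-1` V) (fC x V fxV)).
Qed.

Lemma hausdorff_nbhs (T : topologicalType) (x y : T) : hausdorff_space T -> x <> y ->
  exists U V, [/\ nbhs x U, nbhs y V & forall z, U z -> ~ V z].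
Proof.
move=> hT xy; apply: contrapT => noUV; apply: xy; apply: hT => U V xU yV.
apply: contrapT => UV0; apply: noUV; exists U, V; split=> // z Uz Vz.
by apply: UV0; exists z.
Qed.

Lemma nbhs_sub (H : topologicalZmodType) (x y : H) (U : set H) : nbhs (x - y) U ->
  exists V W, [/\ nbhs x V, nbhs y W & forall v w, V v -> W w -> U (v - w)].
Proof.
move=> xyU; have [[V W] [/= xV yW] VW] := @sub_continuous H (x, y) U xyU.
by exists V, W; split=> // v w Vv Ww; exact: (VW (v, w)).
Qed.

(** * Separation of subsequences along a binary tree *)

Section Split.
Variable H : topologicalZmodType.
Hypothesis H_hausdorff : hausdorff_space H.
Hypothesis H_cc : countably_compact H.
Hypothesis H_ncs : ~ (exists u : nat -> H, nontrivial_convergent_sequence u).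

Definition separated_along (u : nat -> H) (A B : nat -> Prop) :=
  exists2 O, nbhs (0 : H) O & forall m n, A m -> B n -> ~ O (u m - u n).

(** If [z] were the only possible accumulation point along [A], countable compactness would force
    the subsequence to converge to [z]. Being finite-to-one, it is not eventually constant, so this
    would be a nontrivial convergent sequence. *)
Lemma second_accumulation_point (u : nat -> H) (A : nat -> Prop) (z : H) :
  finite_to_one u -> frequently A ->
  exists2 y : H, y <> z & forall U : set H, nbhs y U -> frequently (fun n => A n /\ U (u n)).
Proof.
move=> u_fto freqA; apply: contrapT => noy.
have [s sI sA] := increasing_choice (fun=> freqA).
suff cvg_us : convergent_sequence (u \o s).
  apply: H_ncs; exists (u \o s); split=> // -[c [N _ usc]].
  have [N' N'u] := u_fto c.
  apply: (N'u (s (maxn N N'))); last by apply: usc; rewrite /= leq_maxl.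
  exact: leq_trans (leq_maxr N _) (increasing_geid sI _).
exists z => U zU; apply: contrapT => nfarU.
have freqU : frequently (fun n => ~ U (u (s n))).
  move=> N; apply: contrapT => noN; apply: nfarU; exists N => // n /= Nn.
  by apply: contrapT => nUn; apply: noN; exists n.
have [t tI tU] := increasing_choice (fun=> freqU).
have [y /accumulationP ysy] := H_cc (u \o s \o t).
apply: noy; exists y => [yz|V /ysy freqV N].
  move: zU; rewrite -yz => /ysy/(_ 0%N)[n _]; exact: tU.
have [n Nn Vn] := freqV N; exists (s (t n)); last by split.
exact: leq_trans (leq_trans Nn (increasing_geid tI n)) (increasing_geid sI _).
Qed.

(** Distinct accumulation points [y] along [A] and [z] along [B] have a nonzero difference.
    Differences of terms near [y] and terms near [z] therefore stay away from [0]. *)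
Lemma separate_pair (u : nat -> H) (A B : nat -> Prop) : finite_to_one u ->
  frequently A -> frequently B ->
  exists A' B', [/\ frequently A', frequently B', forall n, A' n -> A n,
    forall n, B' n -> B n & separated_along u A' B'].
Proof.
move=> u_fto freqA freqB.
(* The argument [0] is arbitrary: any accumulation point along [B] will do. *)
have [z _ zB] := second_accumulation_point 0 u_fto freqB.
have [y yz yA] := second_accumulation_point z u_fto freqA.
have yz0 : 0 <> y - z by move=> /esym/eqP; rewrite subr_eq0 => /eqP.
have [O [P [O0 yzP OP]]] := hausdorff_nbhs H_hausdorff yz0.
have [V [W [yV zW VW]]] := nbhs_sub yzP.
exists (fun n => A n /\ V (u n)), (fun n => B n /\ W (u n)).
split=> [||n []//|n []//|]; [exact: yA|exact: zB|].
by exists O => // m n [_ Vm] [_ Wn] /OP; apply; exact: VW.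
Qed.

Lemma separated_along_sub u (A A' B B' : nat -> Prop) :
  (forall n, A' n -> A n) -> (forall n, B' n -> B n) ->
  separated_along u A B -> separated_along u A' B'.
Proof.
by move=> AA BB [O O0 OP]; exists O => // m n /AA Am /BB; exact: OP.
Qed.

Variables (J : countType) (u : J -> nat -> H).
Hypothesis u_fto : forall j, finite_to_one (u j).

(** The pairs are treated one at a time. The index sets only shrink, so separations already achieved
    persist. *)
Lemma separate_list (L : seq (seq bool * seq bool * J)) (N : seq bool -> nat -> Prop) :
  (forall s, frequently (N s)) ->
  exists N' : seq bool -> nat -> Prop, [/\ forall s, frequently (N' s),
    forall s n, N' s n -> N s n &
    forall s t j, s != t -> (s, t, j) \in L -> separated_along (u j) (N' s) (N' t)].
Proof.
move=> freqN; elim: L => [|[[s t] j] L [N' [freqN' N'N N'L]]]; first by exists N.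
have [->|st] := eqVneq s t.
  exists N'; split=> // s' t' j' st'; rewrite inE => /predU1P[|]; last exact: N'L.
  by move=> [es et _]; rewrite es et eqxx in st'.
have [A [B [freqA freqB AN BN sepAB]]] := separate_pair (u_fto j) (freqN' s) (freqN' t).
pose N'' r := if r == s then A else if r == t then B else N' r.
have N''N' r n : N'' r n -> N' r n.
  by rewrite /N''; case: eqP => [->|_]; [exact: AN|case: eqP => [->|//]; exact: BN].
exists N''; split=> [r|r n /N''N'/N'N//|s' t' j' st'].
  by rewrite /N''; case: eqP => // _; case: eqP.
rewrite inE => /predU1P[[-> -> ->]|stL].
  by rewrite /N'' eqxx eq_sym (negbTE st) eqxx.
by apply: separated_along_sub (N'L _ _ _ st' stL); exact: N''N'.
Qed.

(** Each level treats only finitely many [j], those of code at most [n], yet every [j] is treated at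
    all sufficiently deep levels. *)
Lemma separate_tree : exists N : nat -> seq bool -> nat -> Prop,
  [/\ forall n s, frequently (N n s),
      forall n s m, N n.+1 s m -> N n (take n s) m &
      forall n s t j, size s = n.+1 -> size t = n.+1 -> s != t -> (pickle j <= n)%N ->
        separated_along (u j) (N n.+1 s) (N n.+1 t)].
Proof.
have /choice[f fP] (p : nat * (seq bool -> nat -> Prop)) :
    exists N', (forall s, frequently (p.2 s)) -> [/\ forall s, frequently (N' s),
      forall s m, N' s m -> p.2 (take p.1 s) m &
      forall s t j, size s = p.1.+1 -> size t = p.1.+1 -> s != t -> (pickle j <= p.1)%N ->
        separated_along (u j) (N' s) (N' t)].
  case: p => n N /=; have [freqN|] := pselect (forall s, frequently (N s)); last first.
    by move=> nfreq; exists N => /nfreq.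
  pose L := [seq (st, j) | st <- [seq (tval s, tval t) | s <- enum {: n.+1.-tuple bool},
       t <- enum {: n.+1.-tuple bool}], j <- pmap (@unpickle J) (iota 0 n.+1)].
  have [N' [freqN' N'N N'L]] := separate_list L (fun s => freqN (take n s)).
  exists N' => _; split=> // s t j /eqP sn /eqP tn st jn; apply: N'L => //.
  apply: allpairs_f.
    by apply/allpairsP; exists (Tuple sn, Tuple tn); rewrite !mem_enum.
  by rewrite mem_pmap; apply/mapP; exists (pickle j); rewrite ?pickleK ?mem_iota.
pose fix N n := if n is n'.+1 then f (n', N n') else (fun _ _ => True).
have freqN n s : frequently (N n s).
  elim: n s => [|n IHn] s; first by move=> m; exists m.
  by have [freq _ _] := fP (n, N n) IHn; exact: freq.
exists N; split=> // [n s m|n s t j].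
  by have [_ + _] := fP (n, N n) (freqN n); apply.
by have [_ _] := fP (n, N n) (freqN n); apply.
Qed.

End Split.

(** [a b] is an accumulation point along indices chosen down the branch [b]. Two different branches
    separate at some level, also under [p j], so their limits have different images. The main
    application takes a power of the product group for [X] and the [H]-components of the integer
    combinations for [p j]. *)
Theorem accumulation_family (X : topologicalType) (H : topologicalZmodType)
    (J : countType) (p : J -> X -> H) (g : nat -> X) :
  hausdorff_space H -> countably_compact H ->
  ~ (exists u : nat -> H, nontrivial_convergent_sequence u) ->
  countably_compact X -> (forall j, continuous (p j)) ->
  (forall j, finite_to_one (p j \o g)) ->
  exists a : cantor -> X, (forall b, accumulation_point g (a b)) /\
    forall j b c, b <> c -> p j (a b) <> p j (a c).
Proof.
move=> H_hausdorff H_cc H_ncs X_cc pC pg_fto.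
have [N [freqN NS Nsep]] := separate_tree H_hausdorff H_cc H_ncs pg_fto.
have Nmono (b : cantor) m n k : (m <= n)%N -> N n (mkseq b n) k -> N m (mkseq b m) k.
  move=> /subnK <-; elim: (n - m)%N => // d IHd; rewrite addSn => /NS Nk.
  apply: IHd; move: Nk; rewrite /mkseq -map_take take_iota.
  by rewrite (minn_idPl _) ?leqnSn.
have /choice[s sP] (b : cantor) : exists s : nat -> nat,
    {homo s : m n / (m < n)%N} /\ forall n, N n (mkseq b n) (s n).
  by have [s ? ?] := increasing_choice (fun n => freqN n (mkseq b n)); exists s.
have /choice[a aP] (b : cantor) := X_cc (g \o s b).
exists a; split=> [b|j b c bc pbc]; first exact: accumulation_subseq (sP b).1 (aP b).
have [i bci] : exists i, b i <> c i.
  by apply: contrapT => nobc; apply: bc; apply/funext => i; apply: contrapT => bci;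
     apply: nobc; exists i.
(* At level [n.+1] the branches have split, at [i], and [p j] is among the maps already treated. *)
pose n := maxn i (pickle j).
have [||||O O0 OP] := Nsep n (mkseq b n.+1) (mkseq c n.+1) j.
- by rewrite size_mkseq.
- by rewrite size_mkseq.
- apply/eqP => /(congr1 (fun t => nth false t i)).
  by rewrite !nth_mkseq ?ltnS ?leq_maxl.
- exact: leq_maxr.
have [V [W [bV cW VW]]] : exists V W, [/\ nbhs (p j (a b)) V, nbhs (p j (a c)) W &
    forall v w, V v -> W w -> O (v - w)].
  by apply: nbhs_sub; rewrite pbc subrr.
have /accumulationP ab := aP b; have /accumulationP ac := aP c.
have [k nk Vk] := ab _ (pC j _ V bV) n.+1.
have [l nl Wl] := ac _ (pC j _ W cW) n.+1.
apply: (OP (s b k) (s c l)); [| |exact: VW].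
  exact: Nmono nk ((sP b).2 k).
exact: Nmono nl ((sP c).2 l).
Qed.

(** * Sequences with finite-to-one integer combinations *)

Definition comb (F : zmodType) (r : nat) (v : 'I_r -> F) (k : 'I_r -> int) : F :=
  \sum_j v j *~ k j.

Definition nonzero (r : nat) (k : 'I_r -> int) := exists j, k j != 0.

Definition good (F : zmodType) (r : nat) (g : nat -> 'I_r -> F) :=
  forall k, nonzero k -> finite_to_one (fun n => comb (g n) k).

Definition torsion_free (F : zmodType) :=
  forall (x : F) (k : int), k != 0 -> x *~ k = 0 -> x = 0.

Lemma raddf_comb (F E : zmodType) (h : {additive F -> E}) r (v : 'I_r -> F) k :
  h (comb v k) = comb (h \o v) k.
Proof. by rewrite raddf_sum; apply: eq_bigr => j _; rewrite raddfMz. Qed.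

Lemma comb_comb (F : zmodType) r s (v : 'I_r -> F) (R : 'I_s -> 'I_r -> int) k :
  comb (fun i => comb v (R i)) k = comb v (fun j => \sum_i k i * R i j).
Proof.
rewrite /comb; under eq_bigr do rewrite mulrz_suml.
rewrite exchange_big; apply: eq_bigr => j _ /=.
by rewrite mulrz_sumr; apply: eq_bigr => i _; rewrite mulrzA_C.
Qed.

Lemma comb_delta (F : zmodType) r (v : 'I_r -> F) (i : 'I_r) :
  comb v (fun j => (i == j)%:R) = v i.
Proof.
rewrite /comb (bigD1 i)//= eqxx big1 ?addr0// => j ij.
by rewrite eq_sym (negbTE ij).
Qed.

Lemma combZ (F : zmodType) r (v : 'I_r -> F) e k :
  comb v (fun j => e * k j) = comb v k *~ e.
Proof. by rewrite /comb mulrz_suml; apply: eq_bigr => j _; rewrite mulrzA_C. Qed.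

Lemma combB (F : zmodType) r (v w : 'I_r -> F) k :
  comb (fun j => v j - w j) k = comb v k - comb w k.
Proof. by rewrite /comb -sumrB; apply: eq_bigr => j _; rewrite mulrzBl. Qed.

(* The Smith normal form of the row [k] is [(e, 0, ..., 0)] up to units. *)
Lemma row_primitive r (k : 'I_r.+1 -> int) : nonzero k ->
  exists (e : int) (R S : 'M[int]_r.+1),
    [/\ e != 0, S *m R = 1%:M & forall j, k j = e * R ord0 j].
Proof.
move=> [j0 kj0].
have [L _ [R Runit [d _ kE]]] := int_Smith_normal_form (\row_j k j).
have kj j : k j = (L ord0 ord0 * d`_0) * R ord0 j.
  have := congr1 (fun A : 'rV_r.+1 => A ord0 j) kE; rewrite !mxE => ->.
  rewrite (bigD1 ord0)//= big1 ?addr0; last first.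
    move=> i; rewrite -val_eqE/= => i0.
    rewrite !mxE big1 ?mul0r// => l _.
    by rewrite !mxE (ord1 l) /= eq_sym (negbTE i0) mulr0n mulr0.
  by rewrite !mxE big_ord1 !mxE/= mulr1n.
exists (L ord0 ord0 * d`_0), R, (invmx R); split=> //; last exact: mulVmx.
by apply: contraNneq kj0 => e0; rewrite kj e0 mul0r.
Qed.

Definition reduces_to (F : zmodType) (m r : nat) (f : nat -> 'I_m -> F) :=
  exists (s : nat -> nat) (g : nat -> 'I_r -> F) (A : 'I_m -> 'I_r -> int) d,
    {homo s : m n / (m < n)%N} /\ forall n i, f (s n) i = d i + comb (g n) (A i).

(** Some nonzero combination [k] is constant along a subsequence. A unimodular change of coordinates
    turns [k] into [e] times the first coordinate, which is then constant by torsion-freeness and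
    moves into the constant term. *)
Lemma reduces_to_pred (F : zmodType) m r (f : nat -> 'I_m -> F) s (g : nat -> 'I_r -> F)
    (A : 'I_m -> 'I_r -> int) d :
  torsion_free F -> {homo s : m n / (m < n)%N} ->
  (forall n i, f (s n) i = d i + comb (g n) (A i)) -> ~ good g ->
  exists2 r', (r' < r)%N & reduces_to r' f.
Proof.
move=> Ftf sI fE ngood.
have [k [k0 [c freqc]]] : exists k, nonzero k /\
    exists c, frequently (fun n => comb (g n) k = c).
  apply: contrapT => nok; apply: ngood => k k0 c; apply: contrapT => noN.
  apply: nok; exists k; split=> //; exists c => N; apply: contrapT => non.
  by apply: noN; exists N => n Nn kc; apply: non; exists n.
have [t tI tc] := increasing_choice (fun=> freqc).
clear ngood; case: r => [|r] in g A k fE k0 freqc tc *; first by case: k0 => -[].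
have [e [R [S [e0 SR kE]]]] := row_primitive k0.
pose y n i := comb (g (t n)) (R i).
have y0 n : y n ord0 = y 0%N ord0.
  apply/eqP; rewrite -subr_eq0; apply/eqP; apply: (Ftf _ e) => //.
  rewrite mulrzBl -!combZ; apply/eqP; rewrite subr_eq0.
  by rewrite -!(funext kE) !tc.
have gE n j : g (t n) j = comb (y n) (S j).
  rewrite comb_comb -[LHS]comb_delta; congr comb; apply/funext => l.
  by have := congr1 (fun A : 'M_r.+1 => A j l) SR; rewrite !mxE => <-.
pose B (i : 'I_m) (j : 'I_r.+1) : int := \sum_l A i l * S l j.
exists r => //; exists (s \o t), (fun n i => y n (fintype.lift ord0 i)),
  (fun (i : 'I_m) j => B i (fintype.lift ord0 j)),
  (fun i : 'I_m => d i + y 0%N ord0 *~ B i ord0).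
split=> [m' n mn|n i] /=; first by apply: sI; apply: tI.
rewrite fE -addrA; congr (_ + _).
have -> : g (t n) = fun j => comb (y n) (S j) by apply/funext => j; exact: gE.
by rewrite comb_comb /comb big_ord_recl y0.
Qed.

(** A reduction with the least number of components is good, since [reduces_to_pred] would otherwise
    lower that number. *)
Lemma good_reduction (F : zmodType) m (f : nat -> 'I_m -> F) : torsion_free F ->
  exists r (s : nat -> nat) (g : nat -> 'I_r -> F) (A : 'I_m -> 'I_r -> int) d,
    [/\ (r <= m)%N, {homo s : m n / (m < n)%N}, good g &
      forall n i, f (s n) i = d i + comb (g n) (A i)].
Proof.
move=> Ftf.
have redm : reduces_to m f.
  exists id, f, (fun i j => (i == j)%:R), (fun=> 0).
  by split=> // n i; rewrite comb_delta add0r.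
have [r /asboolP[s [g [A [d [sI fE]]]]] rmin] := @ex_minnP (fun r => `[< reduces_to r f >])
  (ex_intro _ m (asboolT redm)).
exists r, s, g, A, d; split=> //; first by apply: rmin; exact/asboolP.
apply: contrapT => /(reduces_to_pred Ftf sI fE)[r' r'r /asboolP/rmin].
by rewrite leqNgt r'r.
Qed.

Lemma coeff_comb (K : choiceType) r (v : 'I_r -> {freeg K}) k x :
  coeff x (comb v k) = \sum_j coeff x (v j) * k j.
Proof. by rewrite raddf_comb; apply: eq_bigr => j _; rewrite /= mulrzz. Qed.

Lemma torsion_free_freeg (K : choiceType) : torsion_free {freeg K}.
Proof.
move=> D k k0 Dk0; apply/eqP/freeg_eqP => x; rewrite coeff0.
have /eqP := congr1 (coeff x) Dk0.
by rewrite coeff0 raddfMz/= mulrzz mulf_eq0 (negbTE k0) orbF => /eqP.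
Qed.

Lemma eventually_notin (K : eqType) (I : Type) (z : nat -> I -> K) (L : seq K) :
  (forall m n i j, z m i = z n j -> m = n) ->
  exists N, forall n i, (N <= n)%N -> z n i \notin L.
Proof.
move=> zI; elim: L => [|x L [N NL]]; first by exists 0%N.
have [[m [i zx]]|nox] := pselect (exists m i, z m i = x).
  exists (maxn N m.+1) => n j; rewrite geq_max => /andP[Nn mn].
  rewrite inE negb_or NL// andbT -zx; apply/eqP => /zI nm.
  by rewrite nm ltnn in mn.
exists N => n i Nn; rewrite inE negb_or NL// andbT.
by apply/eqP => zx; apply: nox; exists n, i.
Qed.

(** The added generators are chosen outside the supports of [g n]. A combination involving one of
    them has it in its support, and the finite support of a fixed [c] contains it for finitely many
    [n] only. *)
Lemma good_extension (K : choiceType) r s (g : nat -> 'I_r -> {freeg K})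
    (z : nat -> 'I_s -> K) : good g ->
  (forall m n i j, z m i = z n j -> m = n /\ i = j) ->
  exists t : nat -> nat,
    good (fun n (i : 'I_(r + s)) =>
      match fintype.split i with inl a => g n a | inr b => << z (t n) b >> end).
Proof.
move=> g_good zI.
have zI1 m n i j : z m i = z n j -> m = n by move=> /zI[].
pose L n := flatten [seq dom (g n a) | a <- enum 'I_r].
have freqL n : frequently (fun m => forall b, z m b \notin L n).
  have [N NP] := eventually_notin (L n) zI1.
  by move=> m; exists (maxn m N); rewrite ?leq_maxl// => b; apply: NP; exact: leq_maxr.
have [t tI tL] := increasing_choice freqL.
exists t => k k0 c.
have [[b kb]|nob] := pselect (exists b, k (rshift r b) != 0); last first.
  have kr b : k (rshift r b) = 0.
    by apply/eqP; apply: contrapT => kb; apply: nob; exists b; apply/negP.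
  have k0l : nonzero (fun a => k (lshift s a)).
    case: k0 => i; rewrite -(splitK i); case: (fintype.split i) => a /=; first by exists a.
    by rewrite kr eqxx.
  have [N NP] := g_good _ k0l c.
  exists N => n /NP; rewrite /comb big_split_ord/= => gc kc; apply: gc; rewrite -kc.
  rewrite [X in _ + X]big1 ?addr0 => [|b _]; last by rewrite kr mulr0z.
  by apply: eq_bigr => a _; rewrite -/(unsplit (inl a)) unsplitK.
have [N NP] := eventually_notin (dom c) zI1.
exists N => n Nn kc.
have /NP : (N <= t n)%N by apply: leq_trans Nn (increasing_geid tI n).
move=> /(_ b)/negP; apply; rewrite mem_dom -kc coeff_comb big_split_ord/=.
rewrite big1 ?add0r; last first.
  move=> a _; rewrite -/(unsplit (inl a)) unsplitK coeff_outdom ?mul0r//.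
  apply: contra (tL n b) => zin; apply/flattenP; exists (dom (g n a)) => //.
  by apply/mapP; exists a; rewrite ?mem_enum.
rewrite (bigD1 b)//= big1 => [|j jb]; rewrite -/(unsplit (inr _)) unsplitK coeffU mul1r.
  by rewrite eqxx mul1r addr0.
case: eqP => [/zI[_ ejb]|_]; last by rewrite mul0r.
by rewrite ejb eqxx in jb.
Qed.

(** Pads the reduced sequence to exactly [m] components, the format of a task in the recursion; the
    padding enters with coefficient [0]. *)
Lemma good_reduction_freeg (K : choiceType) m (f : nat -> 'I_m -> {freeg K})
    (z : nat -> 'I_m -> K) :
  (forall n n' i j, z n i = z n' j -> n = n' /\ i = j) ->
  exists (s : nat -> nat) (g : nat -> 'I_m -> {freeg K}) (A : 'I_m -> 'I_m -> int) d,
    [/\ {homo s : m n / (m < n)%N}, good g &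
      forall n i, f (s n) i = d i + comb (g n) (A i)].
Proof.
move=> zI.
have [r [s [g [A [d [rm sI g_good fE]]]]]] := good_reduction f (@torsion_free_freeg K).
move: (subnKC rm); move: (m - r)%N => p mE; move: f z zI A d fE rm; rewrite -{m}mE.
move=> f z zI A d fE _.
have [|t good_t] := @good_extension K r p g (fun n j => z n (rshift r j)) g_good.
  by move=> n n' i j /zI[-> /rshift_inj ->].
eexists s, _, (fun i j => match fintype.split j with inl a => A i a | inr _ => 0 end), d.
split; [by []|exact: good_t|] => n i; rewrite fE; congr (_ + _).
rewrite [RHS]/comb big_split_ord/= [X in _ + X]big1 ?addr0 => [|b _]; last first.
  by rewrite -/(unsplit (inr _)) unsplitK mulr0z.
by apply: eq_bigr => a _; rewrite -/(unsplit (inl a)) unsplitK.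
Qed.

(** * Topological groups *)

Lemma cvg_ptws (I : Type) (T : topologicalType) (F : set_system (I -> T)) (f : I -> T) :
  Filter F -> (forall i, (fun g => g i) @ F --> f i) -> F --> (f : {ptws I -> T}).
Proof.
move=> FF Ff; apply/cvg_sup => i; apply/cvg_image.
  by apply/seteqP; split=> // v _; exists (fun=> v).
move=> W /(Ff i) FW; exists ((fun g => g i) @^-1` W) => //.
by apply: image_preimage; apply/seteqP; split=> // v _; exists (fun=> v).
Qed.

Lemma continuous_ptws (X : topologicalType) (I : Type) (T : topologicalType)
    (f : X -> {ptws I -> T}) :
  (forall i, continuous (fun x => f x i)) -> continuous f.
Proof. by move=> fC x; apply: cvg_ptws => i; exact: fC. Qed.

Lemma coord_continuous (I : eqType) (T : topologicalType) (i : I) :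
  continuous (fun f : {ptws I -> T} => f i).
Proof. exact: (@proj_continuous I (fun=> T) i). Qed.

Lemma nbhs_ptws (n : nat) (T : topologicalType) (x : {ptws 'I_n -> T}) (U : set {ptws 'I_n -> T}) :
  nbhs x U <-> exists2 V : 'I_n -> set T, (forall i, nbhs (x i) (V i)) &
    forall y, (forall i, V i (y i)) -> U y.
Proof.
split=> [xU|[V xV VU]].
  (* The filter generated by the boxes around [x]; it converges to [x] because it does so in each
     coordinate. *)
  pose F : set_system ('I_n -> T) := [set U | exists2 V : 'I_n -> set T,
    (forall i, nbhs (x i) (V i)) & forall y, (forall i, V i (y i)) -> U y].
  have FF : Filter F.
    split=> [|A B [V xV VA] [W xW WB]|A B AB [V xV VA]].
    - by exists (fun=> setT) => // i; exact: filterT.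
    - exists (fun i => V i `&` W i) => [i|y VW]; first exact: filterI.
      by split; [apply: VA => i; exact: (VW i).1|apply: WB => i; exact: (VW i).2].
    - by exists V => // y /VA/AB.
  suff Fx : F --> x by exact: (Fx U xU).
  apply: cvg_ptws => i W xW.
  exists (fun j => if j == i then W else setT) => [j|y /(_ i)]; last by rewrite eqxx.
  by case: eqP => [->|_] //; exact: filterT.
have := @filter_forall _ _ (fun i (y : {ptws 'I_n -> T}) => V i (y i)) (nbhs x)
  (nbhs_filter x) (fun i => @coord_continuous _ _ i x _ (xV i)).
exact: filterS.
Qed.

Lemma accumulation_ptws (n : nat) (T : topologicalType) (u : nat -> {ptws 'I_n -> T}) x :
  accumulation_point u x <-> forall V : 'I_n -> set T, (forall i, nbhs (x i) (V i)) ->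
    frequently (fun m => forall i, V i (u m i)).
Proof.
split=> [/accumulationP ux V xV|ux].
  by apply: (ux [set y : {ptws 'I_n -> T} | forall i, V i (y i)]); apply/nbhs_ptws; exists V.
apply/accumulationP => U /nbhs_ptws[V xV VU] N.
by have [m Nm Vm] := ux V xV N; exists m => //; exact: VU.
Qed.

(** Fix an accumulation point [h] of the first components. The second components at late indices
    whose first components are near [h] generate a filter, and compactness gives it a cluster point
    [k]; the pair of [h] and [k] is the accumulation point. *)
Lemma countably_compact_prod (n : nat) (H K : topologicalType) :
  countably_compact {ptws 'I_n -> H} -> compact [set: K] ->
  countably_compact {ptws 'I_n -> (H * K)%type}.
Proof.
move=> Hcc Kc u.
have [h /accumulation_ptws uh] := Hcc (fun m i => (u m i).1).
have Knc : compact [set: {ptws 'I_n -> K}].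
  have := @tychonoff _ (fun _ : 'I_n => K) (fun=> setT) (fun=> Kc).
  by congr compact; apply/seteqP; split.
pose box (A : 'I_n -> set H) m := forall i, A i (u m i).1.
pose F : set_system {ptws 'I_n -> K} := [set W | exists A N, (forall i, nbhs (h i) (A i)) /\
  forall m, (N <= m)%N -> box A m -> W (fun i => (u m i).2)].
have FF : ProperFilter F.
  apply: Build_ProperFilter_ex => [W [A [N [hA AW]]]|].
    have [m Nm Am] := uh A hA N.
    by exists (fun i => (u m i).2); exact: AW.
  split=> [|W W' [A [N [hA AW]]] [A' [N' [hA' AW']]]|W W' WW' [A [N [hA AW]]]].
  - by exists (fun=> setT), 0%N; split=> // i; exact: filterT.
  - exists (fun i => A i `&` A' i), (maxn N N'); split=> [i|m]; first exact: filterI.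
    rewrite geq_max => /andP[Nm N'm] AA'; split.
      by apply: AW => // i; exact: (AA' i).1.
    by apply: AW' => // i; exact: (AA' i).2.
  - by exists A, N; split=> // m Nm Am; apply: WW'; exact: AW.
have [k [_ kF]] := Knc F FF filterT.
exists (fun i => (h i, k i)); apply/accumulation_ptws => V hkV N.
have /choice[AB ABP] i : exists AB : set H * set K,
    [/\ nbhs (h i) AB.1, nbhs (k i) AB.2 & AB.1 `*` AB.2 `<=` V i].
  by have [AB [? ?] ?] := hkV i; exists AB.
have [||y [[m [Nm Am ym]] yB]] := kF [set y | exists m, [/\ (N <= m)%N, box (fun i => (AB i).1) m &
    y = fun i => (u m i).2]] [set y | forall i, (AB i).2 (y i)].
- exists (fun i => (AB i).1), N; split=> [i|m Nm Am]; first by have [] := ABP i.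
  by exists m.
- by apply/nbhs_ptws; exists (fun i => (AB i).2) => // i; have [] := ABP i.
exists m => // i; have [_ _] := ABP i; apply; split; first exact: Am.
by have := yB i; rewrite ym.
Qed.

Lemma hausdorff_prod (X Y : topologicalType) :
  hausdorff_space X -> hausdorff_space Y -> hausdorff_space (X * Y)%type.
Proof.
move=> hX hY [p1 p2] [q1 q2] pq; congr pair.
  apply: hX => U V pU qV.
  have [||z [[Uz _] [Vz _]]] := pq (U `*` setT) (V `*` setT); last by exists z.1.
    by exists (U, setT) => //; split=> //; exact: filterT.
  by exists (V, setT) => //; split=> //; exact: filterT.
apply: hY => U V pU qV.
have [||z [[_ Uz] [_ Vz]]] := pq (setT `*` U) (setT `*` V); last by exists z.2.
  by exists (setT, U) => //; split=> //; exact: filterT.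
by exists (setT, V) => //; split=> //; exact: filterT.
Qed.

Lemma countably_compact_image (X Y : topologicalType) (f : X -> Y) :
  continuous f -> (forall y, exists x, f x = y) -> countably_compact X -> countably_compact Y.
Proof.
move=> fC /choice[g gK] Xcc u; have [x ux] := Xcc (g \o u).
exists (f x); have := accumulation_comp fC ux.
by congr accumulation_point; apply/funext => n /=; exact: gK.
Qed.

Section GroupOperations.
Variables (X : topologicalType) (G : topologicalZmodType).

Lemma continuous_add (f g : X -> G) :
  continuous f -> continuous g -> continuous (fun x => f x + g x).
Proof.
move=> fC gC x; apply: (@continuous_comp _ _ _ (fun x => (f x, g x)) (fun p => p.1 + p.2)).
  by apply: cvg_pair; [exact: fC|exact: gC].
exact: add_continuous.
Qed.

Lemma continuous_mulrz (f : X -> G) (k : int) :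
  continuous f -> continuous (fun x => f x *~ k).
Proof.
move=> fC; have muln n : continuous (fun x => f x *+ n).
  elim: n => [|n IHn]; first by move=> x; exact: cvg_cst.
  have -> : (fun x => f x *+ n.+1) = fun x => f x + f x *+ n by apply/funext => x; rewrite mulrS.
  exact: continuous_add.
case: k => n; first exact: muln.
move=> x; apply: (@continuous_comp _ _ _ (fun x => f x *+ n.+1) -%R); first exact: muln.
exact: opp_continuous.
Qed.

Lemma continuous_comb r (f : X -> 'I_r -> G) k :
  (forall i, continuous (fun x => f x i)) -> continuous (fun x => comb (f x) k).
Proof.
move=> fC; rewrite /comb; elim: (index_enum _) => [|i s IHs].
  have -> : (fun x => \sum_(j <- [::]) f x j *~ k j) = fun=> 0.
    by apply/funext => x; rewrite big_nil.
  by move=> x; exact: cvg_cst.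
have -> : (fun x => \sum_(j <- i :: s) f x j *~ k j) =
    fun x => f x i *~ k i + \sum_(j <- s) f x j *~ k j.
  by apply/funext => x; rewrite big_cons.
by apply: continuous_add => //; exact: continuous_mulrz.
Qed.

End GroupOperations.

(* An alias, because the library already attaches to [prod] the structure of
   topological vector space. *)
Definition group_prod (H K : Type) : Type := (H * K)%type.

Section ProductGroup.
Variables H K : topologicalZmodType.
Local Notation G := (group_prod H K).

HB.instance Definition _ := Topological.copy G (H * K)%type.
HB.instance Definition _ := GRing.Zmodule.copy G (H * K)%type.

Lemma group_prod_sub_continuous : continuous (fun p : G * G => p.1 - p.2).
Proof.
move=> [[x1 x2] [y1 y2]] U [[A B] [/= xyA xyB] ABU].
have [V1 [W1 [xV1 yW1 VW1]]] := nbhs_sub xyA.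
have [V2 [W2 [xV2 yW2 VW2]]] := nbhs_sub xyB.
exists (V1 `*` V2, W1 `*` W2); first by split; [exists (V1, V2)|exists (W1, W2)].
move=> [[a b] [c d]] /= [[Va Vb] [Wc Wd]].
by apply: ABU; split; [exact: VW1|exact: VW2].
Qed.

HB.instance Definition _ :=
  PreTopologicalNmodule_isTopologicalZmodule.Build G group_prod_sub_continuous.

End ProductGroup.

(** The compact group called K in the overview: addition on [bool] is that of Z/2. *)
Definition cube (S : Type) := {ptws S -> bool}.

Section Cube.
Variable S : choiceType.

HB.instance Definition _ := Topological.copy (cube S) {ptws S -> bool}.
HB.instance Definition _ := GRing.Zmodule.copy (cube S) (S -> bool).

Lemma cube_coord_nbhs (x : cube S) s : nbhs x [set y : cube S | y s = x s].
Proof. by apply: (@coord_continuous _ _ s x [set x s]). Qed.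

Lemma cube_sub_continuous : continuous (fun p : cube S * cube S => p.1 - p.2).
Proof.
apply: continuous_ptws => s [x y] U /nbhs_singleton Uxy.
exists ([set z | z s = x s], [set z | z s = y s]).
  by split; exact: cube_coord_nbhs.
by move=> [z t] /= [zx ty]; move: Uxy; rewrite /= !fctE /= zx ty.
Qed.

HB.instance Definition _ :=
  PreTopologicalNmodule_isTopologicalZmodule.Build (cube S) cube_sub_continuous.

Lemma cube_compact : compact [set: cube S].
Proof.
have := @tychonoff S (fun=> bool) (fun=> setT) (fun=> bool_compact).
by congr compact; apply/seteqP; split.
Qed.

Lemma cube_hausdorff : hausdorff_space (cube S).
Proof.
move=> x y xy; apply/funext => s.
have [z [zx zy]] := xy _ _ (cube_coord_nbhs x s) (cube_coord_nbhs y s).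
by rewrite -zx -zy.
Qed.

End Cube.

(* [F] with the coarsest topology making the homomorphism [h] continuous. *)
Definition pullback (F : zmodType) (E : topologicalZmodType) (h : {additive F -> E}) : Type := F.

Section Pullback.
Variables (F : zmodType) (E : topologicalZmodType) (h : {additive F -> E}).
Local Notation G := (pullback h).

HB.instance Definition _ := GRing.Zmodule.on G.
HB.instance Definition _ := Topological.copy G (initial_topology (h : F -> E)).

Lemma nbhs_pullback (x : G) (U : set G) :
  nbhs x U <-> exists2 V : set E, nbhs (h x) V & forall y, V (h y) -> U y.
Proof.
split=> [xU|[V xV VU]].
  move: xU; rewrite nbhsE => -[_ [[V Vop <-] Vx] VU].
  by exists V => [|y Vy]; [exact: open_nbhs_nbhs|exact: VU].
apply: (filterS VU).
exact: (@initial_continuous F E h x V xV).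
Qed.

Lemma pullback_sub_continuous : continuous (fun p : G * G => p.1 - p.2).
Proof.
move=> [x y] U /nbhs_pullback[V]; rewrite raddfB => /nbhs_sub[A [B [xA yB AB]]] VU.
exists ((h : G -> E) @^-1` A, (h : G -> E) @^-1` B).
  by split; apply/nbhs_pullback; [exists A|exists B].
by move=> [a b] /= [Aa Bb]; apply: VU; rewrite raddfB; exact: AB.
Qed.

HB.instance Definition _ :=
  PreTopologicalNmodule_isTopologicalZmodule.Build G pullback_sub_continuous.

Lemma pullback_hausdorff : injective h -> hausdorff_space E -> hausdorff_space G.
Proof.
move=> hI hE x y xy; apply/hI/hE => A B xA yB.
have [||z [Az Bz]] := xy ((h : G -> E) @^-1` A) ((h : G -> E) @^-1` B).
- by apply/nbhs_pullback; exists A.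
- by apply/nbhs_pullback; exists B.
by exists (h z).
Qed.

Lemma accumulation_pullback n (u : nat -> {ptws 'I_n -> G}) (x : {ptws 'I_n -> G}) :
  accumulation_point u x <->
  accumulation_point (fun m => (fun i => h (u m i)) : {ptws 'I_n -> E}) (fun i => h (x i)).
Proof.
split=> /accumulation_ptws ux; apply/accumulation_ptws => V xV.
  by apply: (ux (fun i => (h : G -> E) @^-1` V i)) => i; apply/nbhs_pullback; exists (V i).
have /choice[W WP] i : exists W : set E, nbhs (h (x i)) W /\ forall y, W (h y) -> V i y.
  by have /nbhs_pullback[W] := xV i; exists W.
move=> N; have [m Nm Wm] := ux W (fun i => (WP i).1) N.
by exists m => // i; apply: (WP i).2.
Qed.

Definition to_pullback : F -> G := id.

HB.instance Definition _ := GRing.isZmodMorphism.Build F G to_pullback (fun _ _ => erefl).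

End Pullback.

Lemma free_abelian_pullback (K : choiceType) (E : topologicalZmodType)
  (h : {additive {freeg K} -> E}) : free_abelian (pullback h).
Proof. by exists K, (@to_pullback _ _ h : {additive _ -> _}); exists id. Qed.

(** * Free abelian groups and independent sequences *)

Section FreeExtension.
Variables (K : choiceType) (E : zmodType) (v : K -> E).

Definition freeg_ext (D : {freeg K}) : E := \sum_(z <- dom D) v z *~ coeff z D.

(** [fglift] extends maps into modules, so [E] is viewed as a module over [int]. *)
Let w : K -> zmodule E := v.

#[local] HB.instance Definition _ :=
  GRing.isZmodMorphism.Build {freeg K} (zmodule E) (fglift w) (lift_is_additive w).

Lemma freeg_extE D : freeg_ext D = fglift w D.
Proof.
rewrite -{2}(freeg_sumE D) raddf_sum.
by apply: eq_bigr => z _; rewrite [RHS]liftU.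
Qed.

Lemma freeg_ext_is_zmod_morphism : zmod_morphism freeg_ext.
Proof. by move=> D D'; rewrite !freeg_extE raddfB. Qed.

HB.instance Definition _ :=
  GRing.isZmodMorphism.Build {freeg K} E freeg_ext freeg_ext_is_zmod_morphism.

Lemma freeg_extU z : freeg_ext << z >> = v z.
Proof. by rewrite /freeg_ext domU1 big_seq1 coeffU eqxx mulr1. Qed.

End FreeExtension.

Lemma eq_freeg_ext (K : choiceType) (E : zmodType) (v w : K -> E) D :
  {in dom D, v =1 w} -> freeg_ext v D = freeg_ext w D.
Proof. by move=> vw; apply: eq_big_seq => z /vw ->. Qed.

Lemma freeg_cover (K L : choiceType) (f : L -> K) (D : {freeg K}) :
  (forall z, z \in dom D -> exists w, f w = z) ->
  exists D', freeg_ext (fun w => << f w >> : {freeg K}) D' = D.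
Proof.
move=> fD; rewrite -(freeg_sumE D) big_seq.
elim/big_rec: _ => [|z B zD [D' <-]]; first by exists 0; rewrite raddf0.
have [w <-] := fD z zD.
exists (<< coeff (f w) D *g w >> + D'); rewrite raddfD/=; congr (_ + _).
rewrite -[in LHS](mul1r (coeff _ _)) -[in RHS](mul1r (coeff _ _)) -!mulrzz -!freeg_mulz.
by rewrite raddfMz/= freeg_extU.
Qed.

Section Independent.
Variable H : topologicalZmodType.
Hypothesis H_hausdorff : hausdorff_space H.
Hypothesis H_cc : countably_compact H.
Hypothesis H_ncs : ~ (exists u : nat -> H, nontrivial_convergent_sequence u).

Definition independent (y : nat -> H) :=
  forall n k (c : 'I_n -> int), k != 0 -> y n *~ k <> comb (fun m : 'I_n => y m) c.

(** For [x] of infinite order and k <> 0 the multiples k n x are pairwise distinct, so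
    [accumulation_family] yields continuum many candidates. Countably many equations tie a new term
    to the earlier ones, and each excludes at most one candidate. *)
Lemma independent_exists : non_torsion H -> exists y : nat -> H, independent y.
Proof.
move=> [x x_nt].
pose J := {k : int | k != 0}.
have [||a [_ aI]] := @accumulation_family H H J (fun k h => h *~ val k)
    (fun n => x *+ n) H_hausdorff H_cc H_ncs H_cc.
- by move=> k; apply: continuous_mulrz => h; exact: cvg_id.
- move=> [k k0] /= c.
  have [[n nc]|non] := pselect (exists n, x *+ n *~ k = c); last first.
    by exists 0%N => n _ nc; apply: non; exists n.
  exists n.+1 => m nm mc.
  have : x *+ (m - n) *~ k = 0.
    by rewrite mulrnBr ?(ltnW nm)// mulrzBl [X in X - _]mc [X in _ - X]nc subrr.
  rewrite -[_ *+ (m - n)]/(x *~ (m - n)%N%:Z) -mulrzA => xk0.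
  apply: (x_nt `|((m - n)%N%:Z * k)%R|%N).
    by rewrite absz_gt0 mulf_neq0// -lt0n subn_gt0.
  rewrite -[LHS]/(x *~ `|((m - n)%N%:Z * k)%R|%N%:Z) abszE.
  by case: (Num.Theory.ger0P ((m - n)%N%:Z * k)) => _; rewrite ?mulrNz xk0 ?oppr0.
have nat_swo : strict_well_order (fun m n : nat => (m < n)%N).
  split; last by move=> m n /eqP; rewrite neq_ltn => /orP.
  by move=> n; elim: n {-2}n (leqnn n) => [|n IHn] m mn; split=> l lm;
    [move: (leq_trans lm mn)|apply: IHn; rewrite -ltnS; exact: leq_trans lm mn].
apply: (@wf_choice nat _ H (fun n u y => forall k (c : 'I_n -> int), k != 0 ->
    y *~ k <> comb (fun m : 'I_n => u m) c) 0 nat_swo).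
  move=> n u u' y uu' uP k c k0; rewrite (_ : comb _ c = comb (fun m : 'I_n => u m) c).
    exact: uP.
  by apply: eq_bigr => m _; rewrite uu'.
move=> n u _; apply: contrapT => noy.
(* If every [a b] were excluded, an equation excluding it would be a code for [b] in a countable
   type. *)
have /choice[f fP] (b : cantor) : exists kc : J * {ffun 'I_n -> int},
    a b *~ val kc.1 = comb (fun m : 'I_n => u m) kc.2.
  apply: contrapT => nokc; apply: noy; exists (a b) => k c k0 ac; apply: nokc.
  exists (Sub k k0, finfun c); rewrite SubK ac; apply: eq_bigr => m _; by rewrite ffunE.
apply: (@not_embeds_cantor_countable (J * {ffun 'I_n -> int})%type).
exists f => b c fbc; apply: contrapT => bc.
by apply: (aI (f b).1 b c bc); rewrite {2}fbc !fP fbc.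
Qed.

Lemma independent_comb (y : nat -> H) n (c : 'I_n -> int) : independent y ->
  comb (fun m : 'I_n => y m) c = 0 -> forall m, c m = 0.
Proof.
move=> yI; elim: n c => [|n IHn] c; first by move=> _ [].
rewrite /comb big_ord_recr/= => /eqP; rewrite addrC addr_eq0 => /eqP cy.
have cn : c ord_max = 0.
  apply/eqP; apply: contrapT => /negP cn.
  apply: (yI n (c ord_max) (fun m => - c (widen_ord (leqnSn n) m)) cn).
  by rewrite cy -sumrN; apply: eq_bigr => m _; rewrite mulrNz.
move: cy; rewrite cn mulr0z => /esym/eqP; rewrite oppr_eq0 => /eqP cy m.
have [->//|mn] := eqVneq m ord_max.
have mn' : (m < n)%N by have := ltn_ord m; rewrite ltnS leq_eqVlt -[m == n :> nat]/(m == ord_max) (negbTE mn).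
have := IHn (fun m => c (widen_ord (leqnSn n) m)) cy (Ordinal mn').
by congr (c _ = 0); exact: val_inj.
Qed.

End Independent.

(** * The recursion *)

Definition coord (H : topologicalZmodType) (S : choiceType) (s : S) (p : group_prod H (cube S)) : bool :=
  p.2 s.

Lemma coord_is_zmod_morphism H S s : zmod_morphism (@coord H S s).
Proof. by []. Qed.

HB.instance Definition _ (H : topologicalZmodType) (S : choiceType) (s : S) :=
  GRing.isZmodMorphism.Build (group_prod H (cube S)) bool (coord s) (@coord_is_zmod_morphism H S s).

Section Construction.
Variables (M : nat) (H : topologicalZmodType).
Hypothesis H_hausdorff : hausdorff_space H.
Hypothesis H_cc : countably_compact H.
Hypothesis H_ncs : ~ (exists u : nat -> H, nontrivial_convergent_sequence u).
Hypothesis HM_cc : countably_compact {ptws 'I_M -> H}.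
Variable y : nat -> H.
Hypothesis y_independent : independent y.

(** A coordinate is a set of indices together with a direction. Having all sets of indices available
    allows any two disjoint neighbourhoods to be told apart in [witness_separated]. *)
Definition coordinate : Type := {classic cantor * 'I_M.+1}.
HB.instance Definition _ := Choice.on coordinate.
Local Notation E := (group_prod H (cube coordinate)).

Variables (W : choiceType) (lt : W -> W -> Prop).
Hypothesis lt_swo : strict_well_order lt.
Hypothesis small : forall x, ~ embeds cantor (tree {z | ~ lt x z}).

Definition gens : Type := (W * 'I_M + nat)%type.
HB.instance Definition _ := Choice.on gens.
Local Notation F := {freeg gens}.

Definition witness_gen (n : nat) (j : 'I_M.+1) : gens := inr (n * M.+1 + j)%N.

(* [witness_gen n j] is sent to the sequence whose coordinate at [(A, i)] is
   [1] exactly when [i = j] and [n \in A]. *)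
Definition base_value (m : nat) : E :=
  (y m, (fun s : coordinate => (s.2 == inord (m %% M.+1)) && s.1 (m %/ M.+1)%N) : cube coordinate).

Definition gen_value (v : W -> 'I_M -> E) (z : gens) : E :=
  match z with inl p => v p.1 p.2 | inr m => base_value m end.

Definition value v : F -> E := freeg_ext (gen_value v).
HB.instance Definition _ v := GRing.Additive.copy (value v) (freeg_ext (gen_value v)).

Definition witness (n : nat) : {ptws 'I_M.+1 -> E} :=
  fun j => base_value (n * M.+1 + j).

Lemma coord_witness n j A i : coord ((A, i) : coordinate) (witness n j) = (i == j) && A n.
Proof.
rewrite /coord/= modnMDl divnMDl// modn_small// divn_small// addn0.
by congr ((_ == _) && _); apply/val_inj; rewrite /= inordK.
Qed.

Definition below x (D : F) := forall z, z \in dom D ->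
  match z with inl p => lt p.1 x | inr _ => True end.

Lemma eq_value x v v' D : below x D -> (forall z, lt z x -> v z = v' z) ->
  value v D = value v' D.
Proof.
by move=> Dx vv'; apply: eq_freeg_ext => -[[z i]|m] //= /Dx/= /vv' ->.
Qed.

Definition block x (i : 'I_M) : F := << inl (x, i) : gens >>.
Definition block_coeff x (D : F) (i : 'I_M) : int := coeff (inl (x, i) : gens) D.

Lemma value_block v x i : value v (block x i) = v x i.
Proof. by rewrite /value freeg_extU. Qed.

Lemma value_comb v x k : value v (comb (block x) k) = comb (v x) k.
Proof. by rewrite raddf_comb; apply: eq_bigr => i _; rewrite /= value_block. Qed.

Lemma coeff_block x i z : coeff z (block x i) = (inl (x, i) == z)%:R.
Proof. by rewrite /block coeffU mul1r. Qed.

(** Splits off the block of the topmost stage; the remainder involves earlier stages and base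
    generators only. *)
Lemma below_top x D : (forall z i, (inl (z, i) : gens) \in dom D -> ~ lt x z) ->
  below x (D - comb (block x) (block_coeff x D)).
Proof.
move=> Dx [[z i]|m] //=; rewrite mem_dom raddfB/= coeff_comb.
have [->|zx] := eqVneq z x.
  rewrite (bigD1 i)//= coeff_block eqxx mul1r big1 ?addr0 ?subrr ?eqxx// => j ji.
  rewrite coeff_block; case: eqP => [[ji']|]; last by rewrite mul0r.
  by rewrite ji' eqxx in ji.
rewrite big1 => [|j _]; last first.
  rewrite coeff_block; case: eqP => [[xz _]|]; last by rewrite mul0r.
  by rewrite xz eqxx in zx.
rewrite subr0 -mem_dom => /Dx xz.
by have /lt_swo.2[//|/xz] : z <> x by exact/eqP.
Qed.

Lemma top_exists (s : seq gens) :
  (exists x, (forall z i, (inl (z, i) : gens) \in s -> ~ lt x z) /\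
     exists i, (inl (x, i) : gens) \in s) \/
  forall p, (inl p : gens) \notin s.
Proof.
pose t := pmap (fun z : gens => if z is inl p then Some p else None) s.
have tP p : (p \in t) = ((inl p : gens) \in s).
  rewrite mem_pmap; apply/mapP/idP => [[[q|//] qs [->]]//|ps].
  by exists (inl p).
have [t0|tn0] := eqVneq t [::]; first by right=> p; rewrite -tP t0.
have [[x i] xt xmax] := swo_seq_max lt_swo fst (elimN eqP tn0).
left; exists x; split; first by move=> z j; rewrite -tP => /xmax.
by exists i; rewrite -tP.
Qed.

Lemma base_combE (D : F) : (forall p, (inl p : gens) \notin dom D) ->
  exists N, D = comb (fun m : 'I_N => << inr (val m) : gens >>)
    (fun m => coeff (inr (val m) : gens) D).
Proof.
move=> Dbase.
pose t := pmap (fun z : gens => if z is inr m then Some m else None) (dom D).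
exists (\max_(m <- t) m).+1; apply/eqP/freeg_eqP => z.
rewrite coeff_comb; case: z => [p|m].
  rewrite coeff_outdom// big1// => m _.
  by rewrite coeffU mul1r; case: eqP => //; rewrite mul0r.
have [mN|mN] := ltnP m (\max_(m <- t) m).+1.
  rewrite (bigD1 (Ordinal mN))//= coeffU eqxx !mul1r big1 ?addr0// => l.
  rewrite -val_eqE/= => lm; rewrite coeffU mul1r.
  by case: eqP => [[lm']|]; rewrite ?mul0r// lm' eqxx in lm *.
rewrite coeff_outdom; last first.
  apply/negP => mD; move: mN; rewrite ltnNge leq_bigmax_seq//.
  by rewrite mem_pmap; apply/mapP; exists (inr m).
rewrite big1// => l _; rewrite coeffU mul1r.
case: eqP => [[lm]|]; last by rewrite mul0r.
by move: (ltn_ord l); rewrite lm ltnS leqNgt mN.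
Qed.

(** The [H]-component is compared because the cube is annihilated by [2] and cannot detect
    independence over the integers. *)
Definition independent_at x v (a : 'I_M -> E) :=
  forall k D, nonzero k -> below x D -> (comb a k).1 <> (value v D).1.

(** A topmost block in the support of [D] would violate independence at its stage; without such
    blocks, independence of [y] applies. The predicate [X] allows use in the middle of the
    recursion, when only the stages before some [x] are known to be independent. *)
Lemma value_inj (X : W -> Prop) v (D : F) : (forall x, X x -> independent_at x v (v x)) ->
  (forall z i, (inl (z, i) : gens) \in dom D -> X z) -> (value v D).1 = 0 -> D = 0.
Proof.
move=> Xind DX vD0.
have [[x [xmax [i xiD]]]|Dbase] := top_exists (dom D); last first.
  have [N DE] := base_combE Dbase.
  have c0 : forall m : 'I_N, coeff (inr (val m) : gens) D = 0.
    apply: (independent_comb y_independent).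
    move: vD0; rewrite [in value v _]DE => vD0; rewrite -[RHS]vD0.
    rewrite raddf_comb (raddf_comb (@fst H (cube coordinate))).
    by apply: eq_bigr => m _; rewrite /= /value freeg_extU.
  by rewrite DE /comb big1// => m _; rewrite c0 mulr0z.
have := below_top xmax; set k := block_coeff x D => Dk.
case: (Xind x (DX _ _ xiD) (fun i => - k i) (D - comb (block x) k)) => //.
  by exists i; rewrite oppr_eq0 /k /block_coeff -mem_dom.
rewrite raddfB/= value_comb vD0 sub0r -(raddfN (@fst H (cube coordinate))); congr (_.1).
by rewrite -sumrN; apply: eq_bigr => j _; rewrite mulrNz.
Qed.

Lemma nbhs_coord (p : E) (A : cantor) :
  nbhs p [set q : E | forall i, coord ((A, i) : coordinate) q = coord ((A, i) : coordinate) p].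
Proof.
exists (setT, [set f : cube coordinate | forall i : 'I_M.+1, f (A, i) = p.2 (A, i)]).
  split; first exact: filterT.
  exact: (@filter_forall (cube coordinate) 'I_M.+1 (fun i f => f (A, i) = p.2 (A, i)) (nbhs p.2)
    (nbhs_filter p.2) (fun i => cube_coord_nbhs p.2 (A, i))).
by move=> q [_ /=].
Qed.

Lemma witness_separated (h : 'I_M.+1 -> E) (T : 'I_M.+1 -> 'I_M -> int) (a a' : 'I_M -> E) :
  accumulation_point witness (fun j => h j + comb a (T j)) ->
  accumulation_point witness (fun j => h j + comb a' (T j)) ->
  forall j, comb a (T j) = comb a' (T j).
Proof.
set b := fun j => h j + comb a (T j); set b' := fun j => h j + comb a' (T j).
move=> /accumulation_ptws wb /accumulation_ptws wb' j0; apply: contrapT => aa'.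
have bb' : b j0 <> b' j0 by move=> /addrI.
have E_hausdorff := hausdorff_prod H_hausdorff (@cube_hausdorff coordinate).
have [U [U' [bU bU' UU']]] := hausdorff_nbhs E_hausdorff bb'.
(* [A] collects the indices at which the witness is near [b] in position [j0]; none of them has it
   near [b'] there. *)
pose A n := `[< U (witness n j0) >].
(* Near [b] the index lies in [A], so the coordinates attached to [A] form the identity matrix; near
   [b'] it does not, and they vanish. *)
have bA i j : coord ((A, i) : coordinate) (b j) = (i == j).
  have [|n _ nP] := wb (fun j => [set q | (j = j0 -> U q) /\
      forall i, coord ((A, i) : coordinate) q = coord ((A, i) : coordinate) (b j)]) _ 0%N.
    move=> l; apply: filterI; last exact: nbhs_coord.
    by have [->|lj] := eqVneq l j0; [apply: filterS bU|apply: filterE => q lj'; rewrite lj' eqxx in lj].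
  have An : A n by apply/asboolP; exact: (nP j0).1.
  by rewrite -(nP j).2 coord_witness An andbT.
have b'A i j : coord ((A, i) : coordinate) (b' j) = false.
  have [|n _ nP] := wb' (fun j => [set q | (j = j0 -> U' q) /\
      forall i, coord ((A, i) : coordinate) q = coord ((A, i) : coordinate) (b' j)]) _ 0%N.
    move=> l; apply: filterI; last exact: nbhs_coord.
    by have [->|lj] := eqVneq l j0; [apply: filterS bU'|apply: filterE => q lj'; rewrite lj' eqxx in lj].
  have /negbTE nAn : ~~ A n by apply/asboolPn => /UU'; apply; exact: (nP j0).1.
  by rewrite -(nP j).2 coord_witness nAn andbF.
(* The identity of size [M.+1] over Z/2 would factor through dimension [M], by way of [T] and the
   coordinates of the differences of [a] and [a']. *)
suff /mulmx1_min : (\matrix_(j < M.+1, l < M) ((T j l)%:~R : bool)) *m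
    (\matrix_(l < M, i < M.+1)
      (coord ((A, i) : coordinate) (a l) - coord ((A, i) : coordinate) (a' l))) = 1%:M.
  by rewrite ltnn.
apply/matrixP => j i; rewrite !mxE.
transitivity (coord ((A, i) : coordinate) (b j) - coord ((A, i) : coordinate) (b' j)); last first.
  by rewrite bA b'A subr0 eq_sym; case: eqP.
rewrite -(raddfB (coord ((A, i) : coordinate))) opprD addrACA subrr add0r -combB
  (raddf_comb (coord ((A, i) : coordinate))).
by apply: eq_bigr => l _; rewrite !mxE mulrzl; congr (_ *~ _); exact: raddfB.
Qed.

(** * Admissible values for a new block of generators *)

Variable task : W -> nat -> 'I_M -> F.

(** The clauses serve, in order, the injectivity of [value v], the failure of countable compactness
    in the next power, and countable compactness of the power itself. The second excludes the
    accumulation points of [witness] whose topmost stage is [x]. *)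
Definition admissible x v (a : 'I_M -> E) :=
  [/\ independent_at x v a,
      forall (D : 'I_M.+1 -> F) (T : 'I_M.+1 -> 'I_M -> int),
        (forall j, below x (D j)) -> (exists j, nonzero (T j)) ->
        ~ accumulation_point witness (fun j => value v (D j) + comb a (T j)) &
      (forall n i, below x (task x n i)) -> good (task x) ->
        accumulation_point (fun n => (fun i => value v (task x n i)) : {ptws 'I_M -> E}) a].

Lemma eq_admissible x v v' a : (forall z, lt z x -> v z = v' z) ->
  admissible x v a -> admissible x v' a.
Proof.
move=> vv' [ind nacc acc]; split=> [k D k0 Dx|D T Dx T0|fx f_good].
- by rewrite -(eq_value Dx vv'); exact: ind.
- rewrite -(_ : (fun j => value v (D j) + comb a (T j)) = fun j => value v' (D j) + comb a (T j)).
    exact: nacc.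
  by apply/funext => j; rewrite (eq_value (Dx j) vv').
- rewrite -(_ : (fun n => (fun i => value v (task x n i)) : {ptws 'I_M -> E}) =
      fun n => (fun i => value v' (task x n i)) : {ptws 'I_M -> E}).
    exact: acc.
  by apply/funext => n; apply/funext => i; rewrite (eq_value (fx n i) vv').
Qed.

(** The base generators in rows of length [M]: a substitute for unusable tasks, and the padding for
    [good_reduction_freeg]. *)
Definition fresh (n : nat) (i : 'I_M) : gens := inr (n * M + i)%N.

Lemma fresh_inj n n' i i' : fresh n i = fresh n' i' -> n = n' /\ i = i'.
Proof.
have M_gt0 : (0 < M)%N by apply: leq_ltn_trans (ltn_ord i).
move=> [nn']; have := congr1 (fun m => m %/ M)%N nn'; have := congr1 (fun m => m %% M)%N nn'.
rewrite !divnMDl// !modnMDl !modn_small// !divn_small// !addn0 => ii' ->.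
by split=> //; exact: val_inj.
Qed.

Lemma fresh_good : good (fun n i => << fresh n i >> : F).
Proof.
move=> k [i0 ki0] c.
have [N NP] := @eventually_notin _ _ fresh (dom c) (fun m n i j e => (fresh_inj e).1).
exists N => n Nn kc; have /negP := NP n i0 Nn; apply; rewrite -kc mem_dom coeff_comb.
rewrite (bigD1 i0)//= coeffU eqxx !mul1r big1 ?addr0// => j ji0.
rewrite coeffU mul1r; case: eqP => [/fresh_inj[_ e]|]; last by rewrite mul0r.
by rewrite e eqxx in ji0.
Qed.

Lemma below_fresh x n i : below x (<< fresh n i >> : F).
Proof. by move=> z; rewrite domU1 inE => /eqP ->. Qed.

Lemma belowB x D D' : below x D -> below x D' -> below x (D - D').
Proof. by move=> Dx D'x z /domB; rewrite mem_cat => /orP[/Dx|/D'x]. Qed.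

Lemma below_comb x r (f : 'I_r -> F) k : (forall i, below x (f i)) -> below x (comb f k).
Proof.
move=> fx z; rewrite mem_dom coeff_comb => nz.
have [i zi] : exists i, z \in dom (f i).
  apply: contrapT => noi; move/eqP: nz; apply; rewrite big1// => i _.
  by rewrite coeff_outdom ?mul0r//; apply/negP => zi; apply: noi; exists i.
exact: fx zi.
Qed.

(** A counting argument. Each inadmissible candidate [a b] satisfies a condition coded in [Q], each
    condition holds for at most one [b], and [Q] embeds in the trees over the stages up to [x],
    hence is too small for the continuum. *)
Lemma admissible_exists x v : (forall z, lt z x -> admissible z v (v z)) ->
  exists a, admissible x v a.
Proof.
move=> vadm.
have inj D : below x D -> (value v D).1 = 0 -> D = 0.
  move=> Dx; apply: (@value_inj (fun z => lt z x)) => [z /vadm[]//|z i /Dx//].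
have [f [f_good fx f_task]] : exists f : nat -> 'I_M -> F, [/\ good f,
    forall n i, below x (f n i) &
    (forall n i, below x (task x n i)) -> good (task x) -> f = task x].
  (* If the task is unusable, the fresh generators replace it, so that a family of candidates exists
     in every case. *)
  have [[tx t_good]|not_t] := pselect ((forall n i, below x (task x n i)) /\ good (task x)).
    by exists (task x).
  exists (fun n i => << fresh n i >>); split.
  - exact: fresh_good.
  - by move=> n i; exact: below_fresh.
  - by move=> tx t_good; case: not_t.
pose J := {k : {ffun 'I_M -> int} | [exists i, k i != 0]}.
pose g n : {ptws 'I_M -> E} := fun i => value v (f n i).
have [||a [ga aI]] := @accumulation_family {ptws 'I_M -> E} H J (fun k a => (comb a (val k)).1)
    g H_hausdorff H_cc H_ncs (countably_compact_prod HM_cc (@cube_compact coordinate)).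
- move=> k.
  have -> : (fun a : {ptws 'I_M -> E} => (comb a (val k)).1) =
      fun a : {ptws 'I_M -> E} => comb (fun i => (a i).1) (val k).
    by apply/funext => a; rewrite (raddf_comb (@fst H (cube coordinate))).
  apply: continuous_comb => i a; apply: (@continuous_comp _ _ _ (fun a : {ptws 'I_M -> E} => a i) fst).
    exact: coord_continuous.
  exact: cvg_fst.
- move=> [k /= /existsP[i0 ki0]] c; have k0 : nonzero k by exists i0.
  have gE n : (comb (g n) k).1 = (value v (comb (f n) k)).1 by rewrite [in RHS]raddf_comb.
  have [[n0 n0c]|non] := pselect (exists n, (comb (g n) k).1 = c); last first.
    by exists 0%N => n _ nc; apply: non; exists n.
  (* On sums below [x], a vanishing [H]-component forces the sum to vanish. Thus repeating the value
     taken at [n0] means repeating the combination of [f] itself, which happens finitely often. *)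
  have [N NP] := f_good k k0 (comb (f n0) k).
  exists N => n /NP nn0 /= nc; apply: nn0; apply/eqP; rewrite -subr_eq0; apply/eqP/inj.
    by apply: belowB; apply: below_comb => i; exact: fx.
  rewrite raddfB/= -!gE.
  by rewrite [X in X - _]nc [X in _ - X]n0c subrr.
apply: contrapT => noa.
pose Kx : choiceType := ({classic {z | ~ lt x z}} * 'I_M + nat)%type.
pose inc (z : Kx) : gens := match z with inl p => inl (sval p.1, p.2) | inr m => inr m end.
pose incl : {freeg Kx} -> F := freeg_ext (fun z => << inc z >>).
have incl_cover D : below x D -> exists D', incl D' = D.
  move=> Dx; apply: freeg_cover => -[[z i]|m] zD; last by exists (inr m).
  by exists (inl (exist _ z (swo_asym lt_swo (Dx _ zD)), i)).
pose Q := ({ffun 'I_M -> int} * {freeg Kx} +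
  {ffun 'I_M.+1 -> {freeg Kx}} * {ffun 'I_M.+1 -> {ffun 'I_M -> int}})%type.
pose bad (q : Q) b := match q with
  | inl (k, D) => nonzero k /\ (comb (a b) k).1 = (value v (incl D)).1
  | inr (D, T) => (exists j, nonzero (T j)) /\
      accumulation_point witness (fun j => value v (incl (D j)) + comb (a b) (T j))
  end.
(* For equations this is the separation of the family under combinations; for accumulation points of
   [witness], [witness_separated] first reduces to that case. *)
have bad_uniq q b c : bad q b -> bad q c -> b = c.
  case: q => [[k D] [[i0 ki0] kb] [_ kc]|[D T] [[j [i0 Tj]] Tb] [_ Tc]]; apply: contrapT => bc.
    have kJ : [exists i, k i != 0] by apply/existsP; exists i0.
    by apply: (aI (Sub k kJ) b c bc); rewrite SubK kb kc.
  have TJ : [exists i, T j i != 0] by apply/existsP; exists i0.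
  by apply: (aI (Sub (T j) TJ) b c bc); rewrite SubK (witness_separated Tb Tc).
have /choice[h hP] b : exists q, bad q b.
  apply: contrapT => noq; apply: noa; exists (a b); split=> [k D k0 Dx kD|D T Dx [j Tj] DT|tx t_good].
  - have [D' D'E] := incl_cover D Dx; apply: noq; exists (inl (finfun k, D')).
    have kE : (finfun k : 'I_M -> int) = k by apply/funext => i; rewrite ffunE.
    by rewrite /= kE D'E.
  - have /choice[D' D'E] j' := incl_cover _ (Dx j'); apply: noq.
    exists (inr (finfun D', [ffun j => finfun (T j)])) => /=.
    have TE j' : ([ffun j => finfun (T j)] j' : 'I_M -> int) = T j'.
      by apply/funext => i; rewrite !ffunE.
    split; first by exists j; rewrite TE.
    rewrite (_ : (fun _ => _) = fun j => value v (D j) + comb (a b) (T j))//.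
    by apply/funext => j'; rewrite TE ffunE D'E.
  - by rewrite -(f_task tx t_good); exact: ga.
apply: (small (x := x)); apply: (@embeds_trans _ Q).
  by exists h => b c hbc; apply: (bad_uniq (h b)) => //; rewrite hbc.
have treeK : embeds {freeg Kx} (tree {z | ~ lt x z}).
  apply: embeds_freeg; apply: embeds_seq_tree; apply: embeds_prod_tree.
    exact: embeds_countable_tree.
  apply: embeds_sum_tree; last exact: embeds_countable_tree.
  by apply: embeds_prod_tree; [exact: embeds_leaf|exact: embeds_countable_tree].
apply: embeds_sum_tree; apply: embeds_prod_tree => //.
- exact: embeds_countable_tree.
- by apply: embeds_ffun; exact: embeds_seq_tree.
- exact: embeds_countable_tree.
Qed.

Lemma value_exists : exists v, forall x, admissible x v (v x).
Proof.
apply: (@wf_choice W lt ('I_M -> E) admissible (fun=> 0) lt_swo).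
  exact: eq_admissible.
exact: admissible_exists.
Qed.

(** * Countable compactness of the powers of the constructed group *)

Variable w0 : W.
Hypothesis bounded : forall u : nat -> W, exists x, forall n, lt (u n) x.
Hypothesis task_cofinal : forall f x, exists2 z, lt x z & task z = f.
Variable v : W -> 'I_M -> E.
Hypothesis v_admissible : forall x, admissible x v (v x).

Lemma value_injective : injective (value v).
Proof.
move=> D D' DD'; apply/eqP; rewrite -subr_eq0; apply/eqP.
apply: (@value_inj (fun=> True) v) => // [x _|]; first by have [] := v_admissible x.
by rewrite raddfB/= DD' subrr.
Qed.

Local Notation G := (@pullback F E (value v)).

(** Only countably many stages occur in the supports, so [bounded] applies; [w0] fills the codes
    that name no stage. *)
Lemma support_bounded (g : nat -> 'I_M -> F) : exists x, forall n i, below x (g n i).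
Proof.
pose w m := if @unpickle (nat * 'I_M * nat)%type m is Some (n, i, l)
  then (if nth (inr 0%N) (dom (g n i)) l is inl p then p.1 else w0) else w0.
have [x wx] := bounded w; exists x => n i [p|//] pD.
have := wx (pickle (n, i, seq.index (inl p : gens) (dom (g n i)))).
by rewrite /w pickleK nth_index.
Qed.

(** After reduction to a good sequence [g], some stage [z] beyond its supports has [g] as its task,
    so [block z] is an accumulation point of [g]. An affine map carries it to one of a subsequence
    of [u]. *)
Lemma power_countably_compact : countably_compact {ptws 'I_M -> G}.
Proof.
move=> u.
have [s [g [A [d [sI g_good uE]]]]] := good_reduction_freeg (u : nat -> 'I_M -> F) fresh_inj.
have [x gx] := support_bounded g.
have [z xz zg] := task_cofinal g x.
have [_ _] := v_admissible z; rewrite zg => acc_g.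
have {}acc_g : accumulation_point (g : nat -> {ptws 'I_M -> G}) (block z).
  apply/accumulation_pullback.
  rewrite [X in accumulation_point _ X](_ : _ = v z); last first.
    by apply/funext => i; exact: value_block.
  apply: acc_g => // n i [p|//] pD.
  exact: (swo_trans lt_swo) (gx n i _ pD) xz.
pose affine (t : {ptws 'I_M -> G}) : {ptws 'I_M -> G} := fun i => (d i : G) + comb t (A i).
have affine_continuous : continuous affine.
  apply: continuous_ptws => i; apply: continuous_add; first exact: (@cst_continuous _ G (d i)).
  by apply: continuous_comb => j; exact: coord_continuous.
exists (affine (block z)); apply: (accumulation_subseq sI).
have := accumulation_comp affine_continuous acc_g.
by congr accumulation_point; apply/funext => n; apply/funext => i; rewrite /= uE.
Qed.

(** An accumulation point of the witness with a topmost stage [x] is ruled out by admissibility at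
    [x]. One made of base generators only is ruled out by a single coordinate of the cube. *)
Lemma next_power_not_countably_compact : ~ countably_compact {ptws 'I_M.+1 -> G}.
Proof.
move=> Gcc.
have [D /accumulation_pullback wD] :=
  Gcc (fun n (j : 'I_M.+1) => << witness_gen n j >> : F).
have {}wD : accumulation_point witness (fun j => value v (D j)).
  rewrite (_ : witness = fun n (j : 'I_M.+1) => value v << witness_gen n j >>)//.
  by apply/funext => n; apply/funext => j; rewrite /value freeg_extU.
pose s := flatten [seq dom (D j) | j <- enum 'I_M.+1].
have domD j t : t \in dom (D j) -> t \in s.
  by move=> tD; apply/flattenP; exists (dom (D j)) => //; apply/mapP; exists j; rewrite ?mem_enum.
have [[x [xmax [i /flattenP[_ /mapP[j0 _ ->] xiD]]]]|base] := top_exists s.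
  have [_ nacc _] := v_admissible x.
  pose T j := block_coeff x (D j).
  apply: (nacc (fun j => D j - comb (block x) (T j)) T).
  - by move=> j; apply: below_top => z i' /domD; exact: xmax.
  - by exists j0, i; rewrite /T /block_coeff -mem_dom.
  rewrite (_ : (fun j => _) = fun j => value v (D j))//.
  by apply/funext => j; rewrite raddfB/= value_comb subrK.
have [N DN] := base_combE (fun p => contra (@domD ord0 _) (base p)).
(* This tail lies beyond the rows of all base generators in [D ord0]: the coordinate ([A], [ord0])
   vanishes there, but is [1] on the witness from [N] on. *)
pose A n := (N <= n)%N.
have DA : coord ((A, ord0) : coordinate) (value v (D ord0)) = false.
  rewrite DN raddf_comb (raddf_comb (coord ((A, ord0) : coordinate))) /comb big1// => m _ /=.
  rewrite /value freeg_extU /coord/= /A leqNgt (leq_ltn_trans (leq_div _ _) (ltn_ord m)) andbF.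
  by rewrite mul0rz.
pose V (j : 'I_M.+1) : set E := [set q | j = ord0 ->
  coord ((A, ord0) : coordinate) q = coord ((A, ord0) : coordinate) (value v (D ord0))].
have VD j : nbhs (value v (D j)) (V j).
  have [->|j0] := eqVneq j ord0; last first.
    by apply: filterE => q j0'; rewrite j0' eqxx in j0.
  by apply: filterS (nbhs_coord (value v (D ord0)) A) => q qA _; exact: qA.
have /accumulation_ptws/(_ V VD N)[n Nn /(_ ord0 erefl)] := wD.
by rewrite coord_witness DA eqxx /A Nn.
Qed.

End Construction.

Theorem theorem10 (M : nat) (M_gt0 : (0 < M)%N) :
  (exists H : topologicalZmodType,
     [/\ hausdorff_space H,
         infinite_set [set: H],
         non_torsion H,
         ~ (exists u : nat -> H, nontrivial_convergent_sequence u)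
       & countably_compact {ptws 'I_M -> H}]) ->
  exists G : topologicalZmodType,
    [/\ hausdorff_space G,
        free_abelian G,
        countably_compact {ptws 'I_M -> G}
      & ~ countably_compact {ptws 'I_M.+1 -> G}].
Proof.
move=> [H [H_hausdorff _ H_nt H_ncs HM_cc]].
have H_cc : countably_compact H.
  apply: (countably_compact_image (@coord_continuous _ H (Ordinal M_gt0))) HM_cc => x.
  by exists (fun=> x).
have [y y_ind] := independent_exists H_hausdorff H_cc H_ncs H_nt.
have [W [lt [lt_swo cW Wc small]]] := continuum_order.
have [w0] : inhabited W by have [f _] := cW; exists; exact: (f xpred0).
have bounded := countable_bounded cW small.
(* There are at most continuum many tasks, so [W] can list each of them cofinally often. *)
have FC : embeds (nat -> 'I_M -> {freeg (gens M W)}) cantor.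
  apply: (@embeds_trans _ (nat -> cantor)); last exact: embeds_fun_cantor.
  apply: embeds_fun; apply: (@embeds_trans _ (seq {freeg (gens M W)})).
    exists (fun f => [seq f i | i <- enum 'I_M]) => f g fg; apply/funext => i.
    by move/eq_in_map: fg; apply; rewrite mem_enum.
  apply: embeds_seq_cantor; apply: embeds_freeg; apply: embeds_seq_cantor.
  apply: embeds_prod_cantor; first exact: embeds_countable_cantor.
  apply: embeds_sum_cantor; last exact: embeds_countable_cantor.
  by apply: embeds_prod_cantor => //; exact: embeds_countable_cantor.
have [task task_cofinal] := cofinal_enumeration cW Wc small (inhabits (fun _ _ => 0)) FC.
have [v v_adm] := value_exists H_hausdorff H_cc H_ncs HM_cc y_ind lt_swo small task.
have v_inj := value_injective y_ind lt_swo v_adm.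
exists (@pullback {freeg (gens M W)} (group_prod H (cube (coordinate M))) (value y v)); split.
- apply: pullback_hausdorff v_inj _.
  exact: hausdorff_prod H_hausdorff (@cube_hausdorff _).
- exact: free_abelian_pullback.
- exact: (power_countably_compact lt_swo w0 bounded task_cofinal v_adm).
- exact: (next_power_not_countably_compact lt_swo v_adm).
Qed.
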